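(* Assume that: (A) $\mathbf{E}$ is a Fréchet space and $\langle \mathbf{q}_k\rangle_{k\in\mathbb{N}}$ is a non-decreasing sequence of seminorms that generates its topology; (B) $X[\mathcal{T}]$ is a locally convex topological vector space whose topology is generated by a filtering family of seminorms $\langle\|\cdot\|_i\rangle_{i\in I}$, and $\langle X_k\rangle_{k\in\mathbb{N}}$ is a non-decreasing sequence of $\mathcal{T}$-closed linear subspaces whose union is $X$; (C) $|||\cdot|||$ is a norm on $X$ that is $\mathcal{T}$-lower-semicontinuous; (D) for every $k\in\mathbb{N}$ the set $C_k=X_k\cap\{u: |||u|||\le k\}$ is such that the topological space $C_k[\mathcal{T}|_{C_k}]$ is compact; (E) $\mathbf{D}:\mathbf{E}\to X^{\bigstar}$ is linear, where $X^\bigstar$ is the algebraic dual of $X$; write $\langle u,\mathbf{D}(v)\rangle=\mathbf{D}(v)(u)$ for $v\in\mathbf{E}$, $u\in X$; (F) for every $v\in\mathbf{E}$ and every $\varepsilon>0$ there are $i\in I$ and $\theta>0$ such that for all $u\in X_{\lceil\varepsilon^{-1}\rceil}$: $|\langle u,\mathbf{D}(v)\rangle|\le\theta\|u\|_i+\varepsilon|||u|||$; (G) for every $k\in\mathbb{N}$ there exists $c_G(k)>0$ such that $|\langle u,\mathbf{D}(v)\rangle|\le c_G(k)\,|||u|||\,\mathbf{q}_k(v)$ whenever $u\in X_k$ and $v\in\mathbf{E}$; (H) for every $k\in\mathbb{N}$ there exists $c_H(k)>0$ such that $|||u|||\le c_H(k)\sup\{|\langle u,\mathbf{D}(v)\rangle|: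 v\in\mathbf{E}\text{ and }\mathbf{q}_k(v)\le1\}$ whenever $u\in X_k$; (I) for every $k\in\mathbb{N}$ and every $u\in X\setminus X_k$ there exists $v\in\mathbf{E}$ such that $\langle u,\mathbf{D}(v)\rangle\ne0$ and $\mathbf{q}_k(v)=0$. Let $\mathcal{C}=\{C_k:k\in\mathbb{N}\}$, let $\mathcal{T}_{\mathcal{C}}$ be the localization of $\mathcal{T}$ by $\mathcal{C}$, and for $F\in X[\mathcal{T}_{\mathcal{C}}]^*$ and $k\in\mathbb{N}$ let $\|F\|^*_k=\sup\{|\langle u,F\rangle|:u\in X_k\text{ and }|||u|||\le1\}$. Then: (K) $X[\mathcal{T}_{\mathcal{C}}]^*[\beta(X^*,X)]$ is a Fréchet space whose topology is generated by the sequence of seminorms $\langle\|\cdot\|^*_k\rangle_k$; (L) $\mathbf{D}:\mathbf{E}\to X[\mathcal{T}_{\mathcal{C}}]^*$ is a (well-defined) linear, continuous, surjective operator; (M) for every $F\in X[\mathcal{T}_{\mathcal{C}}]^*$, every $k\in\mathbb{N}$ such that $\|F\|^*_k>0$, and every $\varepsilon>0$ there exists $v\in\mathbf{E}$ such that $F=\mathbf{D}(v)$ and $\mathbf{q}_k(v)\le(1+\varepsilon)\,c_H(k)\,\|F\|^*_k$; (N) for every $k\in\mathbb{N}$ and $\varepsilon>0$ there exists a map $\mathbf{I}:X[\mathcal{T}_{\mathcal{C}}]^*\cap\{F:\|F\|^*_k>0\}\to\mathbf{E}$ such that: (a) $(\mathbf{D}\circ\mathbf{I})(F)=F$ for all $F\in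 X[\mathcal{T}_{\mathcal{C}}]^*$ with $\|F\|^*_k>0$; (c) $\mathbf{I}$ is continuous; (d) $\mathbf{q}_k(\mathbf{I}(F))\le(1+\varepsilon)\,c_H(k)\,\|F\|^*_k$ for all $F\in X[\mathcal{T}_{\mathcal{C}}]^*$ with $\|F\|^*_k>0$.
   Context: All vector spaces are real; topological vector spaces are Hausdorff. $\mathbb{N}=\{1,2,\dots\}$. $X[\mathcal{T}]$ denotes the set $X$ equipped with the topology $\mathcal{T}$, and $\mathcal{T}|_C=\{E\cap C:E\in\mathcal{T}\}$ is the topology induced on $C\subseteq X$. A family of seminorms generates a locally convex topology in the usual way (it is separating, and finite intersections of closed seminorm balls centred at $0$ form a local base); it is filtering if for all $i_1,\dots,i_N\in I$ there is $i\in I$ with $\max_n\|\cdot\|_{i_n}\le\|\cdot\|_i$. A localizing family in $X$ is a non-empty collection $\mathcal{C}$ of convex subsets of $X$ containing $0$ such that for all $C\in\mathcal{C}$, $x\in X$, $t\in\mathbb{R}$ there is $D\in\mathcal{C}$ with $x+t\cdot C\subseteq D$. Given a locally convex topology $\mathcal{T}$ on $X$ and a localizing family $\mathcal{C}$, the localization $\mathcal{T}_{\mathcal{C}}$ is the locally convex vector topology on $X$ consisting of all $E\subseteq X$ such that for every $x\in E$ there is a convex $V$ with $x\in V\subseteq E$ and $V\cap C\in\mathcal{T}|_C$ for every $C\in\mathcal{C}$. The family $\mathcal{C}=\{C_k\}$ of the claim is a localizing family. $X[\mathcal{T}_{\mathcal{C}}]^*$ is the space of $\mathcal{T}_{\mathcal{C}}$-continuous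 linear forms on $X$, and $\beta(X^*,X)$ is its strong topology, i.e. the topology of uniform convergence on $\mathcal{T}_{\mathcal{C}}$-bounded subsets of $X$. In (L) and (N), $X[\mathcal{T}_{\mathcal{C}}]^*$ (and its subsets) carry the strong topology. A Fréchet space is a metrizable complete locally convex space. *)

(* Defs.v *)
From HB Require Import structures.
From mathcomp Require Import all_boot all_order all_algebra.
From mathcomp Require Import all_classical all_reals all_analysis.

Set Implicit Arguments.
Unset Strict Implicit.
Unset Printing Implicit Defensive.

Import Order.TTheory GRing.Theory Num.Theory.
Import numFieldNormedType.Exports.

Local Open Scope classical_set_scope.
Local Open Scope ring_scope.

Section Seminorms.
Context (R : realType).

Definition is_seminorm (V : lmodType R) (p : V -> R) : Prop :=
  [/\ forall x, 0 <= p x,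
      forall (a : R) x, p (a *: x) = `|a| * p x &
      forall x y, p (x + y) <= p x + p y].

Definition is_norm (V : lmodType R) (p : V -> R) : Prop :=
  is_seminorm p /\ forall x, p x = 0 -> x = 0.

(* The local base at x is the translate of the one at 0.  For seminorms indexed
   by i, P is the set of all of them. *)
Definition generated_by (V : preTopologicalLmodType R) (P : set (V -> R)) :
    Prop :=
  [/\ forall p, P p -> is_seminorm p,
      forall x, (forall p, P p -> p x = 0) -> x = 0 &
      forall (x : V) (U : set V), nbhs x U <->
        exists (n : nat) (p : 'I_n -> V -> R) (r : 'I_n -> R),
          [/\ forall m, P (p m), forall m, 0 < r m &
              \bigcap_m [set y | p m (y - x) <= r m] `<=` U] ].

Definition filtering (V : Type) (I : Type) (p : I -> V -> R) : Prop :=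
  forall (n : nat) (j : 'I_n.+1 -> I),
    exists i, forall m x, p (j m) x <= p i x.

End Seminorms.

Section LocallyConvexSpaces.
Context (R : realType).
Implicit Type V : preTopologicalLmodType R.

(* These are the axioms of a tvsType. *)
Definition locally_convex_tvs V : Prop :=
  [/\ continuous (fun x : V * V => x.1 + x.2),
      continuous (fun z : R^o * V => z.1 *: z.2) &
      exists2 B : set_system V, (forall b, b \in B -> convex_set b) & basis B].

Definition metrizable (T : topologicalType) : Prop :=
  exists d : T -> T -> R,
    [/\ forall x, d x x = 0,
        forall x y, d x y = 0 -> x = y,
        forall x y, d x y = d y x,
        forall x y z, d x z <= d x y + d y z &
        forall x (U : set T), nbhs x U <->
          exists2 e, 0 < e & [set y | d x y < e] `<=` U].

(* The axioms of a tvsType do not relate its uniform structure to its addition.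
   Cauchy filters are therefore those of the translation-invariant uniformity
   of V, and not those of the library's [cauchy]. *)
Definition linear_cauchy V (F : set_system V) : Prop :=
  forall U : set V, nbhs 0 U ->
    exists2 A, F A & forall x y, A x -> A y -> U (x - y).

Definition linear_complete V : Prop :=
  forall F : set_system V, ProperFilter F -> linear_cauchy F ->
    exists l : V, F --> l.

Definition frechet_space V : Prop :=
  [/\ locally_convex_tvs V, metrizable V & linear_complete V].

(* B is absorbed by every neighbourhood of 0. *)
Definition tvs_bounded V (B : set V) : Prop :=
  forall U : set V, nbhs 0 U ->
    exists2 s : R, 0 < s & forall t, s < t -> B `<=` [set t *: u | u in U].

End LocallyConvexSpaces.

Section Localization.
Context (R : realType) (X : preTopologicalLmodType R).

(* X with the localized topology.  C is meant to be a localizing family, but the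
   sets below form a topology for every C. *)
Definition localization (C : set_system X) : Type := X.

Variable C : set_system X.

HB.instance Definition _ := GRing.Lmodule.copy (localization C) X.

Definition localization_open : set_system X := fun E =>
  forall x, E x -> exists V : set X,
    [/\ convex_set V, V x, V `<=` E &
        forall A, C A -> exists2 G : set X, open G & V `&` A = G `&` A].

Let localization_openT : localization_open setT.
Proof.
move=> x _; exists setT; split => // A _; exists setT => //; exact: openT.
Qed.

Let localization_openI : setI_closed localization_open.
Proof.
move=> E F oE oF x [Ex Fx].
have [V [cV Vx VE hV]] := oE x Ex; have [W [cW Wx WF hW]] := oF x Fx.
exists (V `&` W); split => //.
- move=> y z l /set_mem[Vy Wy] /set_mem[Vz Wz].
  apply/mem_set; split; apply/set_mem.
  + by apply: cV; exact/mem_set.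
  + by apply: cW; exact/mem_set.
- by move=> y [/VE ? /WF ?].
- move=> A CA; have [G oG GA] := hV A CA; have [G' oG' GA'] := hW A CA.
  by exists (G `&` G'); [exact: openI | rewrite setIIl GA GA' -setIIl].
Qed.

Let localization_open_bigU (I : Type) (f : I -> set X) :
  (forall i, localization_open (f i)) -> localization_open (\bigcup_i f i).
Proof.
move=> fo x [i _ fx]; have [V [cV Vx Vf hV]] := fo i x fx.
by exists V; split => // y /Vf ?; exists i.
Qed.

HB.instance Definition _ := isOpenTopological.Build (localization C)
  localization_openT localization_openI localization_open_bigU.

End Localization.

Section StrongDual.
Context (R : realType) (V : preTopologicalLmodType R).

Definition continuous_form : {pred V -> R^o} :=
  [pred f | `[< linear f /\ continuous f >]].

Lemma continuous_form_submod_closed : submod_closed continuous_form.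
Proof.
split=> [|a f g /asboolP [lf cf] /asboolP [lg cg]]; apply/asboolP; split.
- by move=> a x y; rewrite scaler0 addr0.
- exact: cst_continuous.
- move=> b x y /=; rewrite !fctE lf lg !scalerDr !scalerA [a * b]mulrC.
  by rewrite addrACA.
- move=> x; rewrite /continuous_at !fctE.
  by apply: cvgD; [apply: cvgZr; exact: cf | exact: cg].
Qed.

HB.instance Definition _ :=
  GRing.isSubmodClosed.Build R (V -> R^o) continuous_form
    continuous_form_submod_closed.

Record strong_dual : Type := StrongDual {
  dual_fun :> V -> R^o;
  dual_funP : dual_fun \in continuous_form }.

HB.instance Definition _ := [isSub for dual_fun].
HB.instance Definition _ := [Choice of strong_dual by <:].
HB.instance Definition _ := [SubChoice_isSubLmodule of strong_dual by <:].

HB.instance Definition _ := Uniform.copy strong_dual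
  (initial_topology
     (dual_fun : strong_dual -> {family @tvs_bounded R V, V -> R^o})).

End StrongDual.

Section LevelSets.
Context (R : realType) (X : preTopologicalLmodType R).
Variables (Xk : nat -> set X) (nu : X -> R).

Definition level_set (k : nat) : set X := Xk k `&` [set u | nu u <= k%:R].

(* Sequences are indexed by k >= 1 throughout; their value at 0 is unused. *)
Definition level_sets : set_system X := level_set @` [set k | (0 < k)%N].

Definition unit_ball_values (k : nat) (F : X -> R) : set R :=
  [set `|F u| | u in Xk k `&` [set u | nu u <= 1]].

Definition dual_seminorm (k : nat) (F : X -> R) : R :=
  sup (unit_ball_values k F).

End LevelSets.

Notation localized_dual Xk nu := (strong_dual (localization (level_sets Xk nu))).

(* Main.v *)
(* The T_C-bounded sets are those contained in some C_k, and a linear form is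
   T_C-continuous iff its restrictions to the C_k are T-continuous; so the
   strong dual is the Frechet space of the seminorms ||.||*_k, and (F), (G) make
   D a continuous operator into it.

   Surjectivity with bounds starts from approximate solvability: if
   ||F||*_k <= r, then D maps the q_k-ball of radius c_H(k) r arbitrarily close
   to F, uniformly on each C_l.  No duality is needed here: as C_l is compact
   and convex, minimax reduces the claim to one u at a time, where it is (H) if
   u is in X_k and (I) otherwise.

   For a continuous right inverse, the approximate solutions v of D v = F form
   convex sets with open lower sections, so a continuous approximate solution
   exists on the metric space of the F; correcting the residual repeatedly, with
   the n-th correction measured by q_(k+n), gives a series that converges
   locally uniformly in F.  Surjectivity and (M) follow from this right
   inverse. *)
From HB Require Import structures.
Require Import Defs.
From mathcomp Require Import all_boot all_order all_algebra.
From mathcomp Require Import all_classical all_reals all_analysis.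
From mathcomp Require Import wochoice.
From mathcomp Require Import ring lra.

Set Implicit Arguments.
Unset Strict Implicit.
Unset Printing Implicit Defensive.

Import Order.TTheory GRing.Theory Num.Theory.
Import numFieldNormedType.Exports.

Local Open Scope classical_set_scope.
Local Open Scope ring_scope.

(** * Seminorms *)

Section SeminormTheory.
Context (R : realType) (V : lmodType R) (p : V -> R).
Context (p_sn : is_seminorm p).

Lemma seminorm_ge0 x : 0 <= p x.
Proof. by have [] := p_sn. Qed.

Lemma seminormZ (a : R) x : p (a *: x) = `|a| * p x.
Proof. by have [] := p_sn. Qed.

Lemma seminormD x y : p (x + y) <= p x + p y.
Proof. by have [] := p_sn. Qed.

Lemma seminorm0 : p 0 = 0.
Proof. by rewrite -(scale0r 0) seminormZ normr0 mul0r. Qed.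

Lemma seminormN x : p (- x) = p x.
Proof. by rewrite -scaleN1r seminormZ normrN1 mul1r. Qed.

Lemma seminormBC x y : p (x - y) = p (y - x).
Proof. by rewrite -seminormN opprB. Qed.

Lemma seminormBD z x y : p (x - y) <= p (x - z) + p (z - y).
Proof. by rewrite -[x - y](subrKA z) seminormD. Qed.

Lemma seminorm_distl x y : p x - p y <= p (x - y).
Proof. by rewrite lerBlDr; have := seminormD (x - y) y; rewrite subrK. Qed.

Lemma seminorm_dist x y : `|p x - p y| <= p (x - y).
Proof.
by rewrite ler_norml seminorm_distl lerNl opprB seminormBC seminorm_distl.
Qed.

Lemma seminorm_conv x y (t : R) : 0 <= t -> t <= 1 ->
  p (t *: x + (1 - t) *: y) <= t * p x + (1 - t) * p y.
Proof.
move=> t0 t1; apply: (le_trans (seminormD _ _)).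
by rewrite !seminormZ !ger0_norm ?subr_ge0.
Qed.

End SeminormTheory.

Lemma convex_setS (R : realType) (V : lmodType R) (A : set V) :
  (forall x y (t : R), 0 <= t -> t <= 1 -> A x -> A y ->
    A (t *: x + (1 - t) *: y)) -> convex_set A.
Proof.
move=> cA x y t /set_mem Ax /set_mem Ay; apply/mem_set.
exact: (cA x y t%:num (ge0 t) (le1 t) Ax Ay).
Qed.

Lemma convr_lt (R : realType) (a b c t : R) : 0 <= t -> t <= 1 ->
  a < c -> b < c -> t * a + (1 - t) * b < c.
Proof.
move=> t0 t1 ac bc; have [->|tn0] := eqVneq t 0.
  by rewrite mul0r add0r subr0 mul1r.
rewrite [ltRHS](_ : c = t * c + (1 - t) * c); last by ring.
by rewrite ltr_leD ?ler_wpM2l ?subr_ge0 ?(ltW bc)// ltr_pM2l// lt_def tn0.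
Qed.

Lemma convr_le (R : realType) (a b c t : R) : 0 <= t -> t <= 1 ->
  a <= c -> b <= c -> t * a + (1 - t) * b <= c.
Proof.
move=> t0 t1 ac bc; rewrite [leRHS](_ : c = t * c + (1 - t) * c); last by ring.
by rewrite lerD ?ler_wpM2l ?subr_ge0.
Qed.

Lemma generated_near (R : realType) (V : preTopologicalLmodType R)
    (P : set (V -> R)) (p : V -> R) (x : V) (r : R) :
  generated_by P -> P p -> 0 < r -> \forall y \near x, p (y - x) < r.
Proof.
move=> [_ _ nbhsV] Pp r0; apply/nbhsV.
exists 1%N, (fun=> p), (fun=> r / 2); split=> // [_|y /(_ ord0 I)/= yr].
  by rewrite divr_gt0.
by apply: (le_lt_trans yr); rewrite ltr_pdivrMr// ltr_pMr// ltr1n.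
Qed.

Lemma generated_continuous (R : realType) (V : preTopologicalLmodType R)
    (P : set (V -> R)) (p : V -> R) :
  generated_by P -> P p -> continuous (p : V -> R^o).
Proof.
move=> gP Pp x; apply/cvgrPdist_lt => e e0.
have [snP _ _] := gP; have sp := snP _ Pp.
near=> y; rewrite distrC (le_lt_trans (seminorm_dist sp _ _))//.
by near: y; exact: (generated_near x gP Pp).
Unshelve. all: by end_near. Qed.

(** * Topologies generated by a non-decreasing sequence of seminorms *)

Section MonotoneSeminorms.
Context (R : realType) (V : preTopologicalLmodType R) (q : nat -> V -> R).
Context (q_mono : forall k l v, (0 < k)%N -> (k <= l)%N -> q k v <= q l v).
Context (q_gen : generated_by (q @` [set k | (0 < k)%N])).

Lemma mono_seminorm k : (0 < k)%N -> is_seminorm (q k).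
Proof. by move=> k0; have [sn _ _] := q_gen; apply: sn; exists k. Qed.

Lemma mono_eq0 x : (forall k, (0 < k)%N -> q k x = 0) -> x = 0.
Proof.
by move=> q0; have [_ sep _] := q_gen; apply: sep => _ [k k0 <-]; exact: q0.
Qed.

Lemma mono_near x k (r : R) : (0 < k)%N -> 0 < r ->
  \forall y \near x, q k (y - x) < r.
Proof. by move=> k0; apply: (generated_near _ q_gen); exists k. Qed.

(** Monotonicity lets a single seminorm, of the largest index and with the smallest radius, replace
    the finitely many of a basic neighbourhood. *)
Lemma mono_nbhsP x (U : set V) : nbhs x U <->
  exists k, exists2 r, (0 < k)%N /\ 0 < r & [set y | q k (y - x) < r] `<=` U.
Proof.
split=> [|[k [r [k0 r0] sU]]]; last exact: filterS sU (mono_near x k0 r0).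
have [_ _ nbhsV] := q_gen; move/nbhsV => [n [p [r [Pp r0 sU]]]].
have /choice[K HK] : forall m : 'I_n, exists k, (0 < k)%N /\ q k = p m.
  by move=> m; have [k k0 qk] := Pp m; exists k.
(* The successor and the default 1 keep the index and the radius positive when the family is
   empty. *)
exists (\max_m K m).+1, (\big[Order.min/1]_m r m).
  by split => //; apply/lt_bigmin.
move=> y /= yr; apply: sU => m _ /=; have [K0 <-] := HK m.
have Km : (K m <= (\max_m K m).+1)%N by rewrite ltnW// ltnS leq_bigmax.
apply: (le_trans (q_mono _ K0 Km)); apply: (le_trans (ltW yr)).
exact: bigmin_le_cond.
Qed.

Lemma mono_open_ball x k (r : R) : (0 < k)%N -> open [set y | q k (y - x) < r].
Proof.
move=> k0; rewrite openE => y /= yr.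
have sq := mono_seminorm k0.
have r0 : 0 < r - q k (y - x) by rewrite subr_gt0.
apply: filterS (mono_near y k0 r0) => z /=; rewrite ltrBrDr => zr.
exact: le_lt_trans (seminormBD sq y _ _) zr.
Qed.

(** Meant for the strong dual, whose type carries no proof of these axioms. *)
Lemma mono_locally_convex : locally_convex_tvs V.
Proof.
split.
- move=> [x y] U /= /mono_nbhsP[k [r [k0 r0] sU]].
  have r20 : 0 < r / 2 by rewrite divr_gt0.
  exists ([set z | q k (z - x) < r / 2], [set z | q k (z - y) < r / 2]).
    by split; exact: mono_near.
  move=> [a b] [/= ar br]; apply: sU => /=.
  rewrite opprD addrACA (le_lt_trans (seminormD (mono_seminorm k0) _ _))//.
  by rewrite (splitr r) ltrD.
- move=> [a x] U /= /mono_nbhsP[k [r [k0 r0] sU]].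
  have sq := mono_seminorm k0; have qx0 := seminorm_ge0 sq x.
  have A0 : 0 < r / 2 / (`|a| + 1) by rewrite !divr_gt0// ltr_wpDl.
  (* The entry 1 gives [|b| <= |a| + 1], which controls [b *: (y - x)]; the other entry controls
     [(b - a) *: x]. *)
  have B0 : 0 < Num.min 1 (r / 2 / (q k x + 1)).
    by rewrite lt_min ltr01 !divr_gt0// ltr_wpDl.
  exists ([set b : R^o | `|a - b| < Num.min 1 (r / 2 / (q k x + 1))],
          [set z | q k (z - x) < r / 2 / (`|a| + 1)]).
    by split; [exact: (@nbhsx_ballx R R^o a _ B0) | exact: mono_near].
  move=> [b y] [/= + yr]; rewrite lt_min => /andP[ab1 abr]; apply: sU => /=.
  rewrite (_ : _ - _ = b *: (y - x) + (b - a) *: x); last first.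
    by rewrite scalerBr scalerBl addrA subrK.
  rewrite (le_lt_trans (seminormD sq _ _))// !(seminormZ sq) (splitr r) ltrD//.
    have : `|b| <= `|a| + 1.
      have := ler_normD (b - a) a; rewrite subrK distrC => h.
      by rewrite (le_trans h)// addrC lerD2l ltW.
    move=> /(ler_wpM2r (seminorm_ge0 sq (y - x))) h; apply: (le_lt_trans h).
    by rewrite mulrC -ltr_pdivlMr// ltr_wpDl.
  rewrite distrC; move: abr; rewrite ltr_pdivlMr ?ltr_wpDl// => h.
  by apply: le_lt_trans h; rewrite ler_wpM2l// lerDl.
- exists [set B | exists x k (r : R), (0 < k)%N /\
                    B = [set y | q k (y - x) < r]].
    move=> B /set_mem[x [k [r [k0 ->]]]]; apply: convex_setS => y z t t0 t1 /=.
    move=> yr zr; have sq := mono_seminorm k0.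
    rewrite (_ : _ - x = t *: (y - x) + (1 - t) *: (z - x)); last first.
      rewrite !scalerBr addrACA -opprD -scalerDl.
      by rewrite [t + _]addrC subrK scale1r.
    exact: le_lt_trans (seminorm_conv sq _ _ t0 t1) (convr_lt t0 t1 yr zr).
  split=> [B [x [k [r [k0 ->]]]]|x U]; first exact: mono_open_ball.
  move=> /mono_nbhsP[k [r [k0 r0] sU]].
  exists [set y | q k (y - x) < r] => //=; split; first by exists x, k, r.
  by rewrite /= subrr (seminorm0 (mono_seminorm k0)).
Qed.

(** A supremum takes the place of the usual weighted series: since the seminorm of index [k.+1] is
    truncated at [k.+1%:R^-1], only finitely many seminorms matter at a given scale. *)
Let dist_set x y : set R :=
  [set Num.min k.+1%:R^-1 (q k.+1 (x - y)) | k in [set: nat]].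

Let dist x y := sup (dist_set x y).

Let dist_has_sup x y : has_sup (dist_set x y).
Proof.
split; first by exists (Num.min 1%:R^-1 (q 1 (x - y))); exists 0%N.
exists 1 => _ [k _ <-]; rewrite ge_min; apply/orP; left.
by rewrite invf_le1// ler1n.
Qed.

Let dist_le x y e :
  (forall k, Num.min k.+1%:R^-1 (q k.+1 (x - y)) <= e) -> dist x y <= e.
Proof.
move=> h; apply: ge_sup; first by case: (dist_has_sup x y).
by move=> _ [k _ <-].
Qed.

Let dist_ge x y k : Num.min k.+1%:R^-1 (q k.+1 (x - y)) <= dist x y.
Proof. by apply: ub_le_sup; [case: (dist_has_sup x y) | exists k]. Qed.

Lemma mono_metrizable : metrizable R V.
Proof.
exists dist; split.
- move=> x; apply/le_anti/andP; split.
    apply: dist_le => k; rewrite ge_min subrr.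
    by rewrite (seminorm0 (mono_seminorm _))// lexx orbT.
  apply: le_trans (dist_ge x x 0); rewrite le_min subrr.
  by rewrite (seminorm0 (mono_seminorm _))// lexx invr_ge0 ler0n.
- move=> x y d0; apply/subr0_eq/mono_eq0 => -[//|k] _.
  have := dist_ge x y k; rewrite d0 ge_min leNgt invr_gt0 ltr0n/= => h.
  by apply/le_anti; rewrite h (seminorm_ge0 (mono_seminorm _)).
- move=> x y; congr (sup _); apply/seteqP; split=> _ [k _ <-];
    by exists k => //; rewrite (seminormBC (mono_seminorm _)).
- move=> x y z; apply: dist_le => k.
  apply: le_trans (lerD (dist_ge x y k) (dist_ge y z k)).
  have sq := mono_seminorm (ltn0Sn k).
  have k0 : 0 <= k.+1%:R^-1 :> R by rewrite invr_ge0.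
  have := seminormBD sq y x z.
  have := seminorm_ge0 sq (x - y); have := seminorm_ge0 sq (y - z).
  set a := q _ (x - y); set b := q _ (y - z); set c := q _ (x - z).
  move: (k.+1%:R^-1) k0 => e e0 b0 a0 abc.
  by case: (leP e a) => ?; case: (leP e b) => ?; case: (leP e c) => ?; lra.
- move=> x U; split=> [/mono_nbhsP[[|k] [r [k0 r0] sU]]|[e e0 sU]] //.
    exists (Num.min k.+1%:R^-1 r) => [|y /=].
      by rewrite lt_min r0 invr_gt0 ltr0n.
    move=> /(le_lt_trans (dist_ge _ _ k)) h; apply: sU => /=.
    rewrite (seminormBC (mono_seminorm _))//; move: h.
    set a := q _ _; move: (k.+1%:R^-1) => c.
    by case: (leP c a) => ?; case: (leP c r) => ?; lra.
  have e20 : 0 < e / 2 by rewrite divr_gt0.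
  (* Beyond [n] the truncation alone gives the bound; up to [n] the seminorm [q n.+1] dominates. *)
  have [n ne] : exists n : nat, n.+1%:R^-1 < e / 2 :> R.
    by exists (Num.truncn (e / 2)^-1); rewrite invf_plt ?posrE// truncnS_gt.
  apply: filterS (mono_near x (ltn0Sn n) e20) => y /= yr; apply: sU => /=.
  apply: (@le_lt_trans _ _ (e / 2)); last by rewrite ltr_pdivrMr// ltr_pMr// ltr1n.
  apply: dist_le => k; rewrite ge_min; have [kn|nk] := leqP k n.
    apply/orP; right; rewrite (seminormBC (mono_seminorm _))//.
    by apply: le_trans (ltW yr); exact: q_mono.
  apply/orP; left; apply: le_trans (ltW ne).
  by rewrite lef_pV2 ?posrE// ler_nat ltnS ltnW.
Qed.

End MonotoneSeminorms.

(** * Minimax *)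

Section FiniteMinimax.
Context (R : realType).

Definition affine_map (U : lmodType R) (f : U -> R) : Prop :=
  forall x y (t : R), 0 <= t -> t <= 1 ->
    f (t *: x + (1 - t) *: y) = t * f x + (1 - t) * f y.

Definition convex_closed (U : lmodType R) (B : set U) : Prop :=
  forall x y (t : R), 0 <= t -> t <= 1 -> B x -> B y ->
    B (t *: x + (1 - t) *: y).

(** Every ratio [g w / - f w] with [g w] nonnegative lies below every ratio [- g u / f u] with [f u]
    positive. A nonnegative number [c] in between makes [c * f + g] nonpositive on [B], and dividing
    by [c + 1] yields the convex combination. *)
Lemma minimax2 (U : lmodType R) (B : set U) (f g : U -> R) :
  convex_closed B -> affine_map f -> affine_map g ->
  (forall u, B u -> f u < 0 \/ g u < 0) ->
  exists2 t : R, 0 <= t <= 1 & forall u, B u -> t * f u + (1 - t) * g u <= 0.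
Proof.
move=> cB af ag fg0.
(* A point where [f] is positive bounds the ratios from above; if there is none, [t = 1] works. *)
have [[u0 [Bu0 fu0]]|] := pselect (exists u, B u /\ 0 < f u); last first.
  move=> nf; exists 1; rewrite ?ler01 ?lexx// => u Bu.
  rewrite subrr mul0r addr0 mul1r leNgt; apply/negP => fu.
  by apply: nf; exists u.
(* Evaluate [g] at the zero of [f] on the segment from [u] to [w]. *)
have key u w : B u -> B w -> 0 < f u -> 0 <= g w ->
    f w < 0 /\ g w / - f w <= - g u / f u.
  move=> Bu Bw fu gw.
  have fw : f w < 0 by have [//|] := fg0 _ Bw; rewrite ltNge gw.
  split => //; rewrite ler_pdivrMr ?oppr_gt0// mulrAC ler_pdivlMr//.
  rewrite mulrNN leNgt; apply/negP => h.
  have fuw : 0 < f u - f w by lra.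
  pose t := - f w / (f u - f w).
  have t0 : 0 <= t by rewrite divr_ge0//; lra.
  have t1 : t <= 1 by rewrite ler_pdivrMr// mul1r; lra.
  have tE : t * (f u - f w) = - f w by rewrite divfK// gt_eqF.
  have := fg0 _ (cB _ _ _ t0 t1 Bu Bw).
  rewrite af// ag// => -[|]; first by rewrite ltNge => /negP; apply; lra.
  rewrite -(pmulr_rlt0 _ fuw) => h'.
  have : (f u - f w) * (t * g u + (1 - t) * g w) = f u * g w - f w * g u.
    transitivity (t * (f u - f w) * g u + (f u - f w - t * (f u - f w)) * g w).
      by ring.
    by rewrite tE; ring.
  by nra.
pose S := [set 0] `|` [set g w / - f w | w in [set w | B w /\ 0 <= g w]].
have hS : has_sup S.
  split; first by exists 0; left.
  exists (Num.max 0 (- g u0 / f u0)) => x [->|[w [Bw gw] <-]].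
    by rewrite le_max lexx.
  by rewrite le_max; have [_ ->] := key _ _ Bu0 Bw fu0 gw; rewrite orbT.
have s0 : 0 <= sup S by apply: ub_le_sup; [case: hS | left].
have s1 : 0 < sup S + 1 by lra.
have sfg u : B u -> sup S * f u + g u <= 0.
  move=> Bu; have [gu|gu] := leP 0 (g u).
    have [|fu] := leP 0 (f u).
      by have [fu|] := fg0 _ Bu; [lra | rewrite ltNge gu].
    have : g u / - f u <= sup S.
      by apply: ub_le_sup; [case: hS | right; exists u].
    by rewrite ler_pdivrMr ?oppr_gt0// mulrN; lra.
  have [fu|fu] := leP (f u) 0; first by nra.
  have : sup S <= - g u / f u.
    apply: ge_sup; first by case: hS.
    move=> x [->|[w [Bw gw] <-]]; last by have [] := key _ _ Bu Bw fu gw.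
    by rewrite divr_ge0//; lra.
  by rewrite ler_pdivlMr//; lra.
exists (sup S / (sup S + 1)).
  apply/andP; split; first by rewrite divr_ge0// ltW.
  by rewrite ler_pdivrMr// mul1r; lra.
move=> u Bu; rewrite -(pmulr_rle0 _ s1).
suff -> : (sup S + 1) * (sup S / (sup S + 1) * f u +
    (1 - sup S / (sup S + 1)) * g u) = sup S * f u + g u by exact: sfg.
by field; rewrite gt_eqF.
Qed.

(** Induction on [s], merging one element at a time into a convex combination by [minimax2]; the
    tolerance [e] pays for the strict inequalities required there. *)
Lemma finite_minimax (U V : lmodType R) (K : set V) (f : U -> V -> R)
    (B : set U) (s : seq V) :
  convex_closed K -> K !=set0 ->
  (forall v, affine_map (f^~ v)) -> (forall u, affine_map (f u)) ->
  convex_closed B ->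
  (forall v, v \in s -> K v) ->
  (forall u, B u -> exists2 v, v \in s & f u v <= 0) ->
  forall e, 0 < e -> exists2 v, K v & forall u, B u -> f u v <= e.
Proof.
move=> cK [v0 Kv0] afl afr; elim: s B => [|v s IH] B cB sK Bs e e0.
  by exists v0 => // u /Bs[].
have e20 : 0 < e / 2 by rewrite divr_gt0.
(* Where [f u v] is nonpositive [v] itself serves, so the tail of [s] only has to handle the rest of
   [B], which is still convex. *)
have [||u [Bu fu]|w Kw fw] := IH (B `&` [set u | 0 < f u v]) _ _ _ _ e20.
- move=> x y t t0 t1 [Bx fx] [By fy]; split; first exact: cB.
  by rewrite /= afl// -oppr_lt0 opprD -!mulrN convr_lt// oppr_lt0.
- by move=> v' v's; apply: sK; rewrite inE v's orbT.
- have [v'] := Bs _ Bu; rewrite inE => /predU1P[->|v's fv'].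
    by rewrite leNgt fu.
  by exists v'.
have Kv : K v by apply: sK; rewrite inE eqxx.
have afB v' : affine_map (fun u => f u v' - e).
  by move=> x y t t0 t1; rewrite afl//; ring.
(* Subtracting [e] turns the weak bounds 0 for [v] and [e / 2] for [w] into a strict alternative. *)
have [|t /andP[t0 t1] ht] := minimax2 cB (afB v) (afB w).
  move=> u Bu; have [fu|fu] := leP (f u v) 0; first by left; lra.
  by right; have := fw u (conj Bu fu); lra.
exists (t *: v + (1 - t) *: w); first exact: cK.
by move=> u Bu; rewrite afr//; have := ht _ Bu; lra.
Qed.

End FiniteMinimax.

(** * Continuous selections on metric spaces *)

(** Membership in [K] is asked only where the weight is positive, because the values averaged below
    are admissible at a point only there. *)
Lemma convex_closed_sum (R : realType) (V : lmodType R) (K : set V)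
    (w : nat -> R) (v : nat -> V) (N : nat) :
  convex_closed K -> (forall n, 0 <= w n) -> (forall n, 0 < w n -> K (v n)) ->
  0 < \sum_(n < N) w n ->
  K ((\sum_(n < N) w n)^-1 *: \sum_(n < N) w n *: v n).
Proof.
move=> cK w0 Kv; elim: N => [|N IH]; first by rewrite big_ord0 ltxx.
rewrite !big_ord_recr/=; set s := \sum_(_ < _) _; set g := \sum_(_ < _) _.
have s0 : 0 <= s by apply: sumr_ge0.
have [wN|wN] := leP (w N) 0.
  have -> : w N = 0 by apply/le_anti; rewrite wN w0.
  by rewrite scale0r !addr0; exact: IH.
have [s00|sn0] := eqVneq s 0.
  suff -> : g = 0.
    by rewrite s00 !add0r scalerA mulVf ?gt_eqF// scale1r => _; exact: Kv.
  rewrite /g big1// => i _.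
  by rewrite (psumr_eq0P (fun (j : 'I_N) _ => w0 j) s00) ?scale0r.
have sp : 0 < s by rewrite lt_def sn0.
move=> swp; have swn : s + w N != 0 by rewrite gt_eqF.
have t0 : 0 <= s / (s + w N) by rewrite divr_ge0// ltW.
have t1 : s / (s + w N) <= 1 by rewrite ler_pdivrMr// mul1r lerDl.
have := cK _ _ _ t0 t1 (IH sp) (Kv _ wN); congr (K _).
rewrite scalerDr !scalerA; rewrite -/s.
by congr (_ *: _ + _ *: _); field; rewrite swn ?sn0.
Qed.

Section Selection.
Context (R : realType) (T : topologicalType) (d : T -> T -> R) (V : tvsType R).
Context (Phi : T -> set V).
Context (dxx : forall x, d x x = 0) (dC : forall x y, d x y = d y x)
  (dD : forall x y z, d x z <= d x y + d y z)
  (d_nbhs : forall x (U : set T), nbhs x U <->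
          exists2 e, 0 < e & [set y | d x y < e] `<=` U).
Context (cPhi : forall x, convex_closed (Phi x)).
Context (oPhi : forall x v, Phi x v -> \forall y \near x, Phi y v).

Let d_ge0 x y : 0 <= d x y.
Proof. by have := dD x y x; rewrite dxx (dC y x); lra. Qed.

Let e (n : nat) : R := n.+1%:R^-1.

Let e_gt0 n : 0 < e n. Proof. by rewrite invr_gt0 ltr0n. Qed.

Let e_le1 n : e n <= 1. Proof. by rewrite invf_le1// ler1n. Qed.

(** Choosing the least admissible value for a well-order makes the choices coherent: two of them
    that are each admissible at both points must agree. *)
Lemma selection_least : exists m : T -> V,
  (forall x, Phi x !=set0 -> Phi x (m x)) /\
  forall x y, Phi x (m y) -> Phi y (m x) -> m x = m y.
Proof.
have [r wo] := well_ordering_principle V.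
have /choice[m mP] : forall x, exists v, Phi x !=set0 ->
    Phi x v /\ forall w, Phi x w -> r v w.
  move=> x; have [[v0 Pv0]|nP] := pselect (Phi x !=set0); last by exists 0.
  have [|v [[Pv lv] _]] := wo [pred v | v \in Phi x].
    by exists v0; exact/mem_set.
  exists v => _; split; first exact/set_mem.
  by move=> w Pw; apply: lv; exact/mem_set.
exists m; split; first by move=> x /mP[].
move=> x y xy yx.
have [|mx lx] := mP x; first by exists (m y).
have [|my ly] := mP y; first by exists (m x).
(* Both values are minimal in the pair that they form, where the minimum is unique. *)
have [|z [_ zu]] := wo [pred v | (v == m x) || (v == m y)].
  by exists (m x); rewrite inE eqxx.
rewrite -(zu (m x)) ?(zu (m y))//; split.
- by rewrite inE eqxx orbT.
- by move=> v /orP[]/eqP ->; exact: ly.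
- by rewrite inE eqxx.
- by move=> v /orP[]/eqP ->; exact: lx.
Qed.

(* Let [m x] be the least element of [Phi x] for a well-order of [V], and [S n]
   the set of the [x] such that [m x] is admissible on the [3 e n]-ball of [x].
   Points of [S n] at distance less than [3 e n] have the same [m], so that
   near [S n] the value [m] is locally constant: this yields one locally finite
   sequence of weights instead of a partition of unity. *)
Lemma metric_selection : exists g : T -> V, forall x, Phi x !=set0 ->
  Phi x (g x) /\ {for x, continuous g}.
Proof.
have [m [mP mE]] := selection_least.
pose S n := [set x | Phi x !=set0 /\ forall y, d x y < 3 * e n -> Phi y (m x)].
(* The supremum [a n] is a 1-Lipschitz bump, positive only within [e n] of [S n]; the element 0
   keeps it defined and nonnegative. *)
pose A n y := [set 0] `|` [set e n - d x y | x in S n].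
pose a n y := sup (A n y).
have A_sup n y : has_sup (A n y).
  split; first by exists 0; left.
  exists 1 => x [->//|[z _ <-]]; have := e_le1 n; have := d_ge0 z y; lra.
have a_ge0 n y : 0 <= a n y by apply: ub_le_sup; [case: (A_sup n y) | left].
have a_le1 n y : a n y <= 1.
  apply: ge_sup; first by case: (A_sup n y).
  move=> x [->//|[z _ <-]]; have := e_le1 n; have := d_ge0 z y; lra.
have a_ge n x y : S n x -> e n - d x y <= a n y.
  by move=> Sx; apply: ub_le_sup; [case: (A_sup n y) | right; exists x].
have a_lip n y z : a n y - a n z <= d y z.
  rewrite lerBlDr; apply: ge_sup; first by case: (A_sup n y).
  move=> _ [->|[x Sx <-]]; first by rewrite addr_ge0.
  by have := a_ge n x z Sx; have := dD x y z; lra.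
have a_gt0 n y : 0 < a n y -> exists2 x, S n x & d x y < e n.
  move=> a0; have [u Au] := sup_adherent a0 (A_sup n y).
  rewrite subrr => u0; case: Au u0 => [->|[x Sx <-]]; first by rewrite ltxx.
  by rewrite subr_gt0 => xy; exists x.
have a_cont n : continuous (a n : T -> R^o).
  move=> x; apply/cvgrPdist_lt => c c0; apply/d_nbhs; exists c => // y /= xy.
  apply: le_lt_trans xy; rewrite ler_norml a_lip andbT.
  by rewrite lerNl opprB dC a_lip.
have a_ex x : Phi x !=set0 -> exists n, S n x.
  move=> Px; have /d_nbhs[c c0 cP] := oPhi (mP _ Px).
  exists (Num.truncn (3 / c)); split=> // y xy; apply: cP => /=.
  apply: (lt_le_trans xy); rewrite ler_pdivrMr// mulrC -ler_pdivrMr//.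
  by rewrite ltW// truncnS_gt.
have /choice[v vP] : forall n, exists vn : T -> V, forall y, 0 < a n y ->
    exists x, [/\ S n x, d x y < e n & vn y = m x].
  move=> n; have /choice[f fP] : forall y, exists u, 0 < a n y ->
      exists x, [/\ S n x, d x y < e n & u = m x].
    move=> y; have [a0|a0] := ltP 0 (a n y); last by exists 0.
    by have [x Sx xy] := a_gt0 _ _ a0; exists (m x) => _; exists x.
  by exists f.
(* The factor 3 in [S n] pays for the three steps from one centre to [y], to [z] and to the other
   centre, so each least value is admissible at the other centre. *)
have vE n y z : 0 < a n y -> 0 < a n z -> d y z < e n -> v n y = v n z.
  move=> /vP[x [[Px Sx] xy ->]] /vP[x' [[Px' Sx'] xz ->]] yz.
  have := dD x y x'; have := dD y z x'; rewrite (dC z) => h1 h2.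
  by apply: mE; [apply: Sx'; rewrite dC | apply: Sx]; lra.
have vPhi n y : 0 < a n y -> Phi y (v n y).
  move=> /vP[x [[Px Sx] xy ->]]; apply: Sx; have := e_gt0 n; lra.
pose sa n y := \sum_(j < n) a j y.
have sa_cont n : continuous (sa n : T -> R^o).
  elim: n => [|n IH] x.
    rewrite (_ : sa 0%N = cst 0); first exact: cvg_cst.
    by apply/funext => y; rewrite /sa big_ord0.
  rewrite (_ : sa n.+1 = sa n \+ a n); last first.
    by apply/funext => y; rewrite /sa big_ord_recr.
  by apply: (@cvgD _ R^o); [exact: IH | exact: a_cont].
(* Near a point where some bump is positive, the subtracted term annihilates [w n] for large [n];
   the first positive bump is left intact. The weights are thus locally finite and their sum is
   positive. *)
pose w n y := Num.max 0 (a n y - n%:R * sa n y).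
have w_cont n : continuous (w n : T -> R^o).
  move=> x; rewrite (_ : w n = cst 0 \max (fun y => a n y - n%:R * sa n y))//.
  apply: continuous_max; first exact: cvg_cst.
  apply: (@cvgB _ R^o); first exact: a_cont.
  by apply: (@cvgM R); [exact: cvg_cst | exact: sa_cont].
have w_ge0 n y : 0 <= w n y by rewrite le_max lexx.
have sa_ge0 n y : 0 <= sa n y by apply: sumr_ge0.
have w_a n y : 0 < w n y -> 0 < a n y.
  rewrite lt_max ltxx/= => h; have : 0 <= n%:R * sa n y by rewrite mulr_ge0.
  lra.
have w_loc x : Phi x !=set0 ->
    exists N, \forall y \near x, forall n, (N <= n)%N -> w n y = 0.
  move=> /a_ex[k Sk].
  (* For such [n] the sum [sa n] contains [a k], which is at least [e k / 2] near [x], so [n] times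
     it reaches 1, an upper bound of [a n]. *)
  exists (maxn k.+1 (Num.truncn (2 / e k)).+1).
  apply/d_nbhs; exists (e k / 2); first by rewrite divr_gt0.
  move=> y /= xy n; rewrite geq_max => /andP[kn en]; apply/max_idPl.
  have := a_ge k x y Sk => ha.
  have : a k y <= sa n y.
    by rewrite /sa (bigD1 (Ordinal kn))//= lerDl sumr_ge0.
  have : 2 / e k <= n%:R.
    by rewrite (le_trans (ltW (truncnS_gt _)))// ler_nat.
  rewrite ler_pdivrMr// => h2 h3; have := a_le1 n y.
  have : n%:R * e k <= 2 * (n%:R * sa n y).
    by rewrite mulrCA ler_wpM2l//; lra.
  lra.
have /choice[N NP] : forall x, exists N,
    Phi x !=set0 -> forall n, (N <= n)%N -> w n x = 0.
  move=> x; have [Px|nP] := pselect (Phi x !=set0); last by exists 0%N.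
  by have [N /nbhs_singleton NP] := w_loc _ Px; exists N.
pose P N y := \sum_(n < N) w n y.
pose G N y := \sum_(n < N) w n y *: v n y.
(* Sums with different valid cutoffs agree, so the cutoff [N y] that varies with the point can be
   replaced near [x] by a fixed [K]. *)
have stable (W : lmodType R) (f : nat -> W) K L :
    (forall n, (K <= n)%N -> f n = 0) ->
    (forall n, (L <= n)%N -> f n = 0) -> \sum_(n < K) f n = \sum_(n < L) f n.
  wlog KL : K L / (K <= L)%N => [wl hK hL|hK _].
    by have [KL|/ltnW KL] := leqP K L; [exact: wl | apply/esym; exact: wl].
  rewrite -(subnKC KL) big_split_ord/= [X in _ = _ + X]big1 ?addr0// => i _.
  by rewrite hK// leq_addr.
have PE x K L : (forall n, (K <= n)%N -> w n x = 0) ->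
    (forall n, (L <= n)%N -> w n x = 0) -> P K x = P L x.
  exact: (stable R^o (w^~ x)).
have GE x K L : (forall n, (K <= n)%N -> w n x = 0) ->
    (forall n, (L <= n)%N -> w n x = 0) -> G K x = G L x.
  move=> hK hL; apply: (stable _ (fun n => w n x *: v n x)) => n h.
    by rewrite hK ?scale0r.
  by rewrite hL ?scale0r.
have P_gt0 x K : Phi x !=set0 -> (forall n, (K <= n)%N -> w n x = 0) ->
    0 < P K x.
  move=> Px hK; have [k Sk] := a_ex _ Px.
  have : exists n, 0 < a n x.
    by exists k; have := a_ge k x x Sk; rewrite dxx subr0; apply: lt_le_trans.
  move=> /ex_minnP[n an nmin].
  have wn : w n x = a n x.
    rewrite /w (_ : sa n x = 0) ?mulr0 ?subr0; first exact/max_idPr.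
    apply: big1 => i _; apply/le_anti; rewrite a_ge0 andbT leNgt.
    by apply/negP => /nmin; rewrite leqNgt ltn_ord.
  have nK : (n < K)%N.
    by rewrite ltnNge; apply/negP => /hK; rewrite wn => a0; rewrite a0 ltxx in an.
  by rewrite /P (bigD1 (Ordinal nK))//= ltr_wpDr ?sumr_ge0// wn.
exists (fun x => (P (N x) x)^-1 *: G (N x) x) => x Px; split.
  apply: (@convex_closed_sum _ _ _ (w^~ x) (v^~ x)) => //; last first.
    by apply: P_gt0 => //; exact: NP.
  by move=> n /w_a; exact: vPhi.
have [K nearK] := w_loc _ Px; have hK := nbhs_singleton nearK.
have nearP : \forall y \near x, Phi y !=set0.
  by apply: filterS (oPhi (mP _ Px)) => y ?; exists (m x).
have Gc : G K y @[y --> x] --> G K x.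
  rewrite /G; elim: K {nearK hK} => [|n IH].
    rewrite big_ord0 (_ : (fun _ => _) = cst 0); first exact: cvg_cst.
    by apply/funext => y; rewrite big_ord0.
  rewrite big_ord_recr/=.
  rewrite (_ : (fun _ => _) =
      (fun y => (\sum_(i < n) w i y *: v i y) + w n y *: v n y)); last first.
    by apply/funext => y; rewrite big_ord_recr.
  apply: (@continuous2_cvg _ V V V _ _ _ _ (fun a b => a + b)) IH _.
    exact: (@add_continuous V (_, _)).
  (* Although [v n] need not be continuous, near [x] either it is constant where the weight is
     positive, by [vE], or the weight vanishes. *)
  have [u uP] : exists u, \forall y \near x, w n y *: v n y = w n y *: u.
    have [[z [az xz]]|nz] := pselect (exists z, 0 < a n z /\ d x z < e n / 2).
      exists (v n z); apply/d_nbhs; exists (e n / 2); first by rewrite divr_gt0.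
      move=> y /= xy; have [ay|ay] := ltP 0 (a n y).
        by rewrite (vE n y z)//; have := dD y x z; rewrite (dC y x); lra.
      suff -> : w n y = 0 by rewrite !scale0r.
      apply/le_anti; rewrite w_ge0 andbT leNgt; apply/negP => /w_a.
      by rewrite ltNge ay.
    exists 0; apply/d_nbhs; exists (e n / 2); first by rewrite divr_gt0.
    move=> y /= xy; suff -> : w n y = 0 by rewrite !scale0r.
    apply/le_anti; rewrite w_ge0 andbT leNgt; apply/negP => /w_a ay.
    by apply: nz; exists y.
  rewrite (nbhs_singleton uP).
  have uE : {near x, (fun y => w n y *: u) =1 (fun y => w n y *: v n y)}.
    by apply: filterS uP => y ->.
  apply: cvg_trans (near_eq_cvg uE) _.
  apply: (@continuous2_cvg _ R^o V V _ _ _ (cst u) (fun a b => a *: b)).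
  - exact: (@scale_continuous R V (_, _)).
  - exact: w_cont.
  - exact: cvg_cst.
have Pc : P K y @[y --> x] --> (P K x : R^o).
  rewrite /P; elim: K {nearK hK Gc} => [|n IH].
    rewrite big_ord0 (_ : (fun _ => _) = cst 0); first exact: cvg_cst.
    by apply/funext => y; rewrite big_ord0.
  rewrite big_ord_recr/=.
  rewrite (_ : (fun _ => _) = (fun y => (\sum_(i < n) w i y) + w n y)); last first.
    by apply/funext => y; rewrite big_ord_recr.
  by apply: (@cvgD _ R^o) => //; exact: w_cont.
have gx : (P (N x) x)^-1 *: G (N x) x = (P K x)^-1 *: G K x.
  by rewrite (PE x _ K) ?(GE x _ K)//; exact: NP.
rewrite /prop_for /continuous_at gx.
have gE : {near x, (fun y => (P K y)^-1 *: G K y) =1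
    (fun y => (P (N y) y)^-1 *: G (N y) y)}.
  near=> y; have yP : Phi y !=set0 by near: y.
  have yK : forall n, (K <= n)%N -> w n y = 0 by near: y.
  by rewrite (PE y _ K) ?(GE y _ K)//; exact: NP.
apply: cvg_trans (near_eq_cvg gE) _.
apply: (@continuous2_cvg _ R^o V V _ _ _ _ (fun a b => a *: b)).
- exact: (@scale_continuous R V (_, _)).
- by apply: (@cvgV R) => //; rewrite gt_eqF// P_gt0.
- exact: Gc.
Unshelve. all: by end_near. Qed.

End Selection.

(** * Localized topologies *)

(** The definition gives an open set around one point at a time; the union of all open sets whose
    trace on [A] lies in [E] serves every point at once. *)
Lemma localization_trace (R : realType) (X : preTopologicalLmodType R)
    (C : set_system X) (E A : set X) :
  localization_open C E -> C A ->
  exists2 G : set X, open G & E `&` A = G `&` A.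
Proof.
move=> oE CA.
exists (\bigcup_(H in [set H | open H /\ H `&` A `<=` E]) H).
  by apply: bigcup_open => H [].
apply/seteqP; split=> x [Ex Ax]; split=> //; last first.
  by have [H [_ HE] Ox] := Ex; exact: HE.
have [V [_ Vx VE hV]] := oE x Ex; have [G oG GA] := hV A CA.
have [Gx _] : (G `&` A) x by rewrite -GA.
exists G => //; split=> // y Gy; apply: VE.
by have [] : (V `&` A) y by rewrite GA.
Qed.

(** For an affine map the preimage of a ball is convex, so it is itself the set [V] that the
    definition of a localized open set requires. *)
Lemma localization_continuous (R : realType) (X : preTopologicalLmodType R)
    (C : set_system X) (f : X -> R^o) :
  affine_map f ->
  (forall A x (e : R), C A -> A x -> 0 < e ->
    \forall y \near x, A y -> `|f x - f y| < e) ->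
  continuous (f : localization C -> R^o).
Proof.
move=> af cf x; pose F := nbhs (x : localization C).
apply/(@cvgrPdist_lt R R^o _ F) => e e0; rewrite /F.
rewrite nbhsE/=; exists [set y | `|f x - f y| < e] => //; split; last first.
  by rewrite /= subrr normr0.
move=> z zE; exists [set y | `|f x - f y| < e]; split=> //.
  apply: convex_setS => a b t t0 t1 /= ax bx; rewrite af//.
  rewrite (_ : _ - _ = t * (f x - f a) + (1 - t) * (f x - f b)); last by ring.
  apply: le_lt_trans (ler_normD _ _) _; rewrite !normrM (ger0_norm t0).
  by rewrite (@ger0_norm _ (1 - t)) ?subr_ge0// convr_lt.
move=> A CA.
exists (\bigcup_(H in [set H | open H /\
    H `&` A `<=` [set y | `|f x - f y| < e]]) H).
  by apply: bigcup_open => H [].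
apply/seteqP; split=> y [Ey Ay]; split=> //; last first.
  by have [H [_ HE] Ox] := Ey; exact: HE.
have e1 : 0 < e - `|f x - f y| by rewrite subr_gt0.
have : nbhs y [set w | A w -> `|f y - f w| < e - `|f x - f y|] by exact: cf e1.
rewrite nbhsE => -[H [oO Hy] HA].
exists H => //; split=> // w [/HA h Aw]; have := h Aw => /= {}h.
by have := ler_distD (f y) (f x) (f w); lra.
Qed.

Lemma localization_continuousP (R : realType) (X : preTopologicalLmodType R)
    (C : set_system X) (f : X -> R^o) :
  continuous (f : localization C -> R^o) ->
  forall A x (e : R), C A -> A x -> 0 < e ->
    \forall y \near x, A y -> `|f x - f y| < e.
Proof.
move=> cf A x e CA Ax e0.
pose F := nbhs (x : localization C).
have /(@cvgrPdist_lt R R^o _ F)/(_ e e0) nF := cf x.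
have : nbhs (x : localization C) [set y | `|f x - f y| < e] by exact: nF.
rewrite nbhsE => -[U [oU Ux] Uf].
have [G oG UG] := localization_trace (oU : localization_open C U) CA.
have Gx : G x by have [] : (G `&` A) x by rewrite -UG.
apply: filterS (open_nbhs_nbhs (conj oG Gx)) => y Gy Ay; apply: Uf.
by have [] : (U `&` A) y by rewrite UG.
Qed.

(** * Level sets and the bounded sets of the localized topology *)

Section LevelSets.
Context (R : realType) (X : tvsType R) (I : Type) (p : I -> X -> R).
Context (p_gen : generated_by (range p)).
Context (Xk : nat -> set X).
Context (Xk_mono : forall k l, (0 < k)%N -> (k <= l)%N -> Xk k `<=` Xk l).
Context (Xk_sub : forall k, (0 < k)%N -> submod_closed (mem (Xk k))).
Context (Xk_closed : forall k, (0 < k)%N -> closed (Xk k)).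
Context (Xk_cover : \bigcup_(k in [set k | (0 < k)%N]) Xk k = [set: X]).
Context (nu : X -> R) (nu_norm : is_norm nu).
Context (nu_lsc : lower_semicontinuous (fun u => (nu u)%:E)).
Context (C_compact : forall k, (0 < k)%N -> compact (level_set Xk nu k)).

Let nu_sn : is_seminorm nu. Proof. by have [] := nu_norm. Qed.

Let C := level_sets Xk nu.

Lemma level_setsP k : (0 < k)%N -> C (level_set Xk nu k).
Proof. by move=> k0; exists k. Qed.

Lemma Xk0 k : (0 < k)%N -> Xk k 0.
Proof. by move=> /Xk_sub[/set_mem]. Qed.

Lemma XkDZ k a u v : (0 < k)%N -> Xk k u -> Xk k v -> Xk k (a *: u + v).
Proof.
move=> k0 ku kv; have [_ h] := Xk_sub k0.
by apply: set_mem; apply: h; exact/mem_set.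
Qed.

Lemma XkZ k a u : (0 < k)%N -> Xk k u -> Xk k (a *: u).
Proof. by move=> k0 ku; rewrite -[_ *: _]addr0; apply: XkDZ => //; exact: Xk0. Qed.

Lemma XkD k u v : (0 < k)%N -> Xk k u -> Xk k v -> Xk k (u + v).
Proof. by move=> k0 ku kv; rewrite -[u]scale1r; exact: XkDZ. Qed.

Lemma XkB k u v : (0 < k)%N -> Xk k u -> Xk k v -> Xk k (u - v).
Proof. by move=> k0 ku kv; apply: XkD => //; rewrite -scaleN1r; exact: XkZ. Qed.

Lemma Xk_ex u : exists2 k, (0 < k)%N & Xk k u.
Proof.
by have [k k0 ku] : (\bigcup_(k in [set k | (0 < k)%N]) Xk k) u;
  [rewrite Xk_cover | exists k].
Qed.

Lemma level_set_mono k l : (0 < k)%N -> (k <= l)%N ->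
  level_set Xk nu k `<=` level_set Xk nu l.
Proof.
move=> k0 kl u [Xu /= nuu]; split; first exact: Xk_mono kl _ Xu.
by rewrite /= (le_trans nuu)// ler_nat.
Qed.

Lemma level_set0 k : (0 < k)%N -> level_set Xk nu k 0.
Proof. by move=> k0; split; [exact: Xk0 | rewrite /= (seminorm0 nu_sn)]. Qed.

Lemma level_set_convex k : (0 < k)%N -> convex_closed (level_set Xk nu k).
Proof.
move=> k0 x y t t0 t1 [Xx nx] [Xy ny]; split.
  by apply: XkDZ => //; exact: XkZ.
by rewrite /= (le_trans (seminorm_conv nu_sn _ _ t0 t1))// convr_le.
Qed.

Lemma level_set_closed k : (0 < k)%N -> closed (level_set Xk nu k).
Proof.
move=> k0; apply: closedI; first exact: Xk_closed.
rewrite -openC; have /lower_semicontinuousP/(_ k%:R) := nu_lsc.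
congr (open _); apply/seteqP; split=> u /=; rewrite lte_fin ltNge.
  by move/negP.
by move=> h; apply/negP.
Qed.

(** Shrinking keeps a point in the level set, so a localized neighbourhood of 0 matters only through
    its trace there, which is that of an original neighbourhood; the seminorms defining the latter
    are bounded by compactness. *)
Lemma level_set_bounded k : (0 < k)%N ->
  tvs_bounded (level_set Xk nu k : set (localization C)).
Proof.
move=> k0 U; rewrite nbhsE => -[E [oE E0] EU].
have [G oG EG] := localization_trace (oE : localization_open C E) (level_setsP k0).
have G0 : G 0.
  have [] // : (G `&` level_set Xk nu k) 0.
  by rewrite -EG; split; [|exact: level_set0].
have [psn _ pnbhs] := p_gen.
have /pnbhs[n [pm [r [Ppm r0 sG]]]] := open_nbhs_nbhs (conj oG G0).
have /choice[M MP] : forall m, exists M, 0 < M /\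
    forall u, level_set Xk nu k u -> pm m u <= M.
  move=> m; have cpm : continuous (pm m : X -> R^o).
    exact: (generated_continuous p_gen (Ppm m)).
  have /compact_bounded[M [_ HM]] :=
    continuous_compact (continuous_subspaceT cpm) (C_compact k0).
  exists (`|M| + 1); split; first by rewrite ltr_wpDl.
  move=> u Cu; apply: le_trans (ler_norm _) _; apply: HM; last by exists u.
  by rewrite (le_lt_trans (ler_norm _))// ltrDl.
(* The 1 forces [t > 1], so that [t^-1 *: u] stays in the level set; the sum dominates each
   [M m / r m]. *)
exists (1 + \sum_m M m / r m).
  by rewrite ltr_wpDr// sumr_ge0// => m _; rewrite divr_ge0// ltW//; case: (MP m).
move=> t st u Cu; have t1 : 1 < t.
  apply: le_lt_trans st; rewrite lerDl sumr_ge0// => m _.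
  by rewrite divr_ge0// ltW//; case: (MP m).
have t0 : 0 < t by lra.
exists (t^-1 *: u); last by rewrite scalerA mulfV ?gt_eqF// scale1r.
have Ctu : level_set Xk nu k (t^-1 *: u).
  have [Xu nuu] := Cu; split; first exact: XkZ.
  rewrite /= (seminormZ nu_sn) gtr0_norm ?invr_gt0// ler_pdivrMl//.
  by apply: le_trans nuu _; rewrite ler_peMl// ltW.
apply: EU; suff [//] : (E `&` level_set Xk nu k) (t^-1 *: u).
rewrite EG; split=> //; apply: sG => m _ /=; rewrite subr0.
rewrite (seminormZ (psn _ (Ppm m))) gtr0_norm ?invr_gt0// ler_pdivrMl//.
have [M0 MC] := MP m; apply: le_trans (MC _ Cu) _.
rewrite -ler_pdivrMr//; apply: le_trans (ltW st).
rewrite (bigD1 m)//= addrCA lerDl addr_ge0// sumr_ge0// => j _.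
by rewrite divr_ge0// ltW//; case: (MP j).
Qed.

(** A basic neighbourhood of [x] misses the closed level set; [W] is the sum of the level set and
    the corresponding open convex neighbourhood of 0. *)
Lemma level_set_thickening k x : (0 < k)%N -> ~ level_set Xk nu k x ->
  exists W : set X, [/\ open W, convex_closed W, level_set Xk nu k `<=` W & ~ W x].
Proof.
move=> k0 nCx; have [psn _ pnbhs] := p_gen.
have : nbhs x (~` level_set Xk nu k).
  by apply: open_nbhs_nbhs; split => //; rewrite openC; exact: level_set_closed.
move=> /pnbhs[n [pm [r [Ppm r0 sC]]]].
exists [set y | exists2 c, level_set Xk nu k c & forall m, pm m (y - c) < r m].
split.
- rewrite openE => y [c Cc yc].
  have : \forall z \near y, forall m, pm m (z - y) < r m - pm m (y - c).
    apply: filter_forall => m; apply: (generated_near _ p_gen (Ppm m)).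
    by rewrite subr_gt0.
  apply: filterS => z zy; exists c => // m.
  have := seminormBD (psn _ (Ppm m)) y z c; have := zy m; lra.
- move=> y z t t0 t1 [c Cc yc] [c' Cc' zc].
  exists (t *: c + (1 - t) *: c'); first exact: level_set_convex.
  move=> m; rewrite opprD addrACA -!scalerBr.
  by rewrite (le_lt_trans (seminorm_conv (psn _ (Ppm m)) _ _ t0 t1))// convr_lt.
- by move=> c Cc; exists c => // m; rewrite subrr (seminorm0 (psn _ (Ppm m))).
- move=> [c Cc xc]; apply: (sC c) => // m _ /=.
  by rewrite (seminormBC (psn _ (Ppm m))) ltW.
Qed.

(* An unbounded sequence is separated from the level sets by thickenings of
   them; only finitely many thickenings cut a given level set, so their
   intersection is a neighbourhood of 0 in the localized topology. *)
Lemma bounded_sub_level_set (B : set X) :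
  tvs_bounded (B : set (localization C)) ->
  exists2 k, (0 < k)%N & B `<=` level_set Xk nu k.
Proof.
move=> bB; apply: contrapT => nB.
(* The level [k * k] leaves room for a division by [k]: the point [k%:R^-1 *: x k] is still outside
   the level set of index [k], whereas absorption with the scalar [k] would put it into [W k]. *)
have /choice[x xP] : forall k, exists x, (0 < k)%N ->
    B x /\ ~ level_set Xk nu (k * k) x.
  move=> k; have [k0|] := posnP k; first by exists 0; rewrite k0.
  move=> k0; apply: contrapT => nx; apply: nB; exists (k * k)%N.
    by rewrite muln_gt0 k0.
  move=> x Bx; apply: contrapT => nCx; apply: nx.
  by exists x.
have yP k : (0 < k)%N -> ~ level_set Xk nu k (k%:R^-1 *: x k).
  move=> k0 [Xy nuy]; have [_] := xP k k0; apply.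
  have kr0 : (k%:R : R) != 0 by rewrite pnatr_eq0 -lt0n.
  have xE : x k = k%:R *: (k%:R^-1 *: x k).
    by rewrite scalerA mulfV// scale1r.
  split; rewrite xE.
    by apply: XkZ; rewrite ?muln_gt0 ?k0//; apply: Xk_mono Xy; rewrite ?leq_pmull.
  by rewrite /= (seminormZ nu_sn) normr_nat natrM ler_wpM2l.
have /choice[W WP] : forall k, exists W : set X, (0 < k)%N ->
    [/\ open W, convex_closed W, level_set Xk nu k `<=` W
      & ~ W (k%:R^-1 *: x k)].
  move=> k; have [k0|k0] := posnP k; first by exists setT; rewrite k0.
  by have [W hW] := level_set_thickening k0 (yP k k0); exists W.
pose V := [set y | forall k, (0 < k)%N -> W k y].
have oV : localization_open C V.
  move=> y Vy; exists V; split=> //.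
    apply: convex_setS => a b t t0 t1 Va Vb k k0.
    by have [_ cW _ _] := WP k k0; apply: cW => //; [exact: Va | exact: Vb].
  move=> _ [l l0 <-]; exists [set y | forall k, (k < l)%N -> (0 < k)%N -> W k y].
    elim: l {l0} => [|l IH].
      by rewrite (_ : [set _ | _] = setT)//; [exact: openT | apply/seteqP].
    rewrite (_ : [set _ | _] = [set y | forall k, (k < l)%N -> (0 < k)%N -> W k y]
        `&` [set y | (0 < l)%N -> W l y]).
      apply: openI => //; have [->|l0] := posnP l.
        by rewrite (_ : [set _ | _] = setT)//; [exact: openT | apply/seteqP].
      have [oW _ _ _] := WP l l0; move: oW; congr open.
      by apply/seteqP; split=> z /=; [|apply].
    apply/seteqP; split=> z /=.
      by move=> h; split=> [k kl|]; apply: h => //; exact: ltnW.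
    by move=> [h hl] k; rewrite ltnS leq_eqVlt => /predU1P[->|]; [|exact: h].
  apply/seteqP; split=> z [Vz Cz]; split=> //; first by move=> k _; exact: Vz.
  move=> k k0; have [/Vz|lk] := ltnP k l; first exact.
  by have [_ _ CW _] := WP k k0; apply: CW; exact: level_set_mono lk _ Cz.
have V0 : V 0.
  by move=> k k0; have [_ _ CW _] := WP k k0; apply: CW; exact: level_set0.
have nV : nbhs (0 : localization C) V by rewrite nbhsE; exists V.
have [s s0 /(_ (Num.truncn s).+1%:R (truncnS_gt _)) sB] := bB V nV.
set k := (Num.truncn s).+1 in sB.
have [Bx _] := xP k (ltn0Sn _); have [u Vu uE] := sB _ Bx.
have [_ _ _] := WP k (ltn0Sn _); rewrite -uE scalerA mulVf ?pnatr_eq0// scale1r.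
by apply; exact: Vu.
Qed.

End LevelSets.

(** * The strong dual *)

Section Dual.
Context (R : realType) (X : tvsType R) (I : Type) (p : I -> X -> R).
Context (p_gen : generated_by (range p)).
Context (Xk : nat -> set X).
Context (Xk_mono : forall k l, (0 < k)%N -> (k <= l)%N -> Xk k `<=` Xk l).
Context (Xk_sub : forall k, (0 < k)%N -> submod_closed (mem (Xk k))).
Context (Xk_closed : forall k, (0 < k)%N -> closed (Xk k)).
Context (Xk_cover : \bigcup_(k in [set k | (0 < k)%N]) Xk k = [set: X]).
Context (nu : X -> R) (nu_norm : is_norm nu).
Context (nu_lsc : lower_semicontinuous (fun u => (nu u)%:E)).
Context (C_compact : forall k, (0 < k)%N -> compact (level_set Xk nu k)).

Let nu_sn : is_seminorm nu. Proof. by have [] := nu_norm. Qed.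

Local Notation LX := (localization (level_sets Xk nu)).
Local Notation Y := (localized_dual Xk nu).

Lemma dual_linear (F : Y) : linear (F : X -> R^o).
Proof. by have /asboolP[] := dual_funP F. Qed.

Lemma dual_continuous (F : Y) : continuous (F : LX -> R^o).
Proof. by have /asboolP[] := dual_funP F. Qed.

Lemma dual0 (F : Y) : F 0 = 0.
Proof. by have := dual_linear F (-1) 0 0; rewrite scaler0 addr0 scaleN1r addNr. Qed.

Lemma dualD (F : Y) u v : F (u + v) = F u + F v.
Proof. by have := dual_linear F 1 u v; rewrite !scale1r. Qed.

Lemma dualZ (F : Y) (a : R) u : F (a *: u) = a * F u.
Proof. by have := dual_linear F a u 0; rewrite !addr0 dual0 addr0. Qed.

Lemma dualN (F : Y) u : F (- u) = - F u.
Proof. by rewrite -scaleN1r dualZ mulN1r. Qed.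

Lemma dual_bounded (F : Y) k : (0 < k)%N ->
  exists2 t, 0 < t & forall u, level_set Xk nu k u -> `|F u| < t.
Proof.
move=> k0; pose U := [set u : LX | `|F u| < 1].
have U0 : nbhs (0 : LX) U.
  pose N := nbhs (0 : LX).
  have /(@cvgrPdist_lt R R^o _ N)/(_ 1 ltr01) h := dual_continuous (F := F) (x := 0).
  by apply: filterS h => u; rewrite dual0 sub0r normrN.
have [s s0 /(_ (s + 1))] := level_set_bounded p_gen Xk_sub nu_norm C_compact k0 U0.
rewrite ltrDl ltr01 => /(_ isT) sC; exists (s + 1); first by lra.
have s1 : 0 < s + 1 by lra.
move=> u /sC[w Uw <-].
by rewrite dualZ normrM gtr0_norm// -ltr_pdivlMl// mulVf ?gt_eqF.
Qed.

Lemma unit_ball_has_sup (F : Y) k : (0 < k)%N ->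
  has_sup (unit_ball_values Xk nu k F).
Proof.
move=> k0; split.
  exists `|F 0|; exists 0 => //; split; first exact: Xk0.
  by rewrite /= (seminorm0 nu_sn).
have [t t0 ht] := dual_bounded F k0; exists t => _ [u [Xu nuu] <-].
by apply/ltW/ht; split => //=; rewrite (le_trans nuu)// ler1n.
Qed.

Lemma dual_seminorm_bound (F : Y) k u : (0 < k)%N -> Xk k u ->
  `|F u| <= dual_seminorm Xk nu k F * nu u.
Proof.
move=> k0 Xu; have [nu0|nu0] := eqVneq (nu u) 0.
  by rewrite nu0 mulr0 ((nu_norm.2 u) nu0) dual0 normr0.
have nup : 0 < nu u by rewrite lt_def nu0 seminorm_ge0.
rewrite -ler_pdivrMr//; apply: ub_le_sup; first by case: (unit_ball_has_sup F k0).
exists ((nu u)^-1 *: u); last first.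
  by rewrite dualZ normrM gtr0_norm ?invr_gt0// mulrC.
split; first exact: XkZ.
by rewrite /= (seminormZ nu_sn) gtr0_norm ?invr_gt0// mulVf.
Qed.

Lemma dual_seminorm_le (F : Y) k c : (0 < k)%N -> 0 <= c ->
  (forall u, Xk k u -> `|F u| <= c * nu u) -> dual_seminorm Xk nu k F <= c.
Proof.
move=> k0 c0 h; apply: ge_sup; first by case: (unit_ball_has_sup F k0).
by move=> _ [u [Xu /= nuu] <-]; rewrite (le_trans (h _ Xu))// ler_piMr.
Qed.

Lemma dual_seminorm_ge0 (F : Y) k : (0 < k)%N -> 0 <= dual_seminorm Xk nu k F.
Proof.
move=> k0; apply: ub_le_sup; first by case: (unit_ball_has_sup F k0).
exists 0; last by rewrite dual0 normr0.
by split; [exact: Xk0 | rewrite /= (seminorm0 nu_sn)].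
Qed.

Lemma dual_seminorm_level (F : Y) k u : (0 < k)%N -> level_set Xk nu k u ->
  `|F u| <= dual_seminorm Xk nu k F * k%:R.
Proof.
move=> k0 [Xu nuu]; apply: le_trans (dual_seminorm_bound F k0 Xu) _.
by rewrite ler_wpM2l// dual_seminorm_ge0.
Qed.

Lemma dual_seminormP k : (0 < k)%N ->
  is_seminorm (fun F : Y => dual_seminorm Xk nu k F).
Proof.
move=> k0; split.
- by move=> F; exact: dual_seminorm_ge0.
- have le a (F : Y) : dual_seminorm Xk nu k (a *: F : Y) <=
      `|a| * dual_seminorm Xk nu k F.
    apply: dual_seminorm_le => //; first by rewrite mulr_ge0// dual_seminorm_ge0.
    move=> u Xu; rewrite -mulrA (_ : (a *: F : Y) u = a * F u)// normrM.
    by rewrite ler_wpM2l//; exact: dual_seminorm_bound.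
  move=> a F; apply/le_anti/andP; split; first exact: le.
  have [->|a0] := eqVneq a 0.
    by rewrite normr0 mul0r; exact: dual_seminorm_ge0.
  have := le a^-1 (a *: F); rewrite scalerA mulVf// scale1r normfV.
  by rewrite ler_pdivlMl ?normr_gt0.
- move=> F G; apply: dual_seminorm_le => //.
    by rewrite addr_ge0// dual_seminorm_ge0.
  move=> u Xu; rewrite (_ : (F + G : Y) u = F u + G u)// mulrDl.
  by rewrite (le_trans (ler_normD _ _))// lerD// dual_seminorm_bound.
Qed.

Lemma dual_seminorm_mono k l (F : Y) : (0 < k)%N -> (k <= l)%N ->
  dual_seminorm Xk nu k F <= dual_seminorm Xk nu l F.
Proof.
move=> k0 kl; have l0 := leq_trans k0 kl.
apply: dual_seminorm_le => //; first exact: dual_seminorm_ge0.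
move=> u Xu; apply: dual_seminorm_bound => //; exact: Xk_mono kl _ Xu.
Qed.

Lemma dual_seminorm_eq0 (F : Y) :
  (forall k, (0 < k)%N -> dual_seminorm Xk nu k F = 0) -> F = 0.
Proof.
move=> F0; apply: val_inj; apply/funext => u /=.
have [k k0 Xu] := Xk_ex Xk_cover u.
have := dual_seminorm_bound F k0 Xu; rewrite F0// mul0r normr_le0.
by move/eqP.
Qed.

(** Unfolds the initial topology into the form in which the strong topology is used below. *)
Lemma cvg_dualP (N : set_system Y) (F : Y) : Filter N ->
  N --> F <-> forall B : set LX, tvs_bounded B ->
    forall e : R, 0 < e ->
      \forall G \near N, forall u, B u -> `|F u - (G : Y) u| < e.
Proof.
move=> FN; pose f := @dual_fun R LX : Y -> {family @tvs_bounded R LX, LX -> R^o}.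
have -> : N --> F <-> f @ N --> (f F).
  split=> [NF A /(@initial_continuous _ _ f F)/NF//|NF A].
  move=> /= [_ [[B oB <-] BF] sBA].
  apply: filterS sBA _; apply: NF.
  by apply: open_nbhs_nbhs.
rewrite fam_cvgP; split=> [h B bB e e0|h B bB A].
  have := h B bB [set g : LX -> R^o |
    forall u, B u -> `|F u - g u| < e]; apply.
  apply/uniform_nbhs; exists [set xy | `|xy.1 - xy.2| < e]; split=> //.
  by rewrite -entourage_ballE; exists e.
move=> /uniform_nbhs[E0 [+ EA]]; rewrite -entourage_ballE => -[e e0 eE].
apply: filterS (h B bB e e0) => G GF; apply: EA => u Bu.
by apply: eE; exact: GF.
Qed.

(** Bounded sets lie in level sets, so the seminorm balls are fine enough; level sets are bounded,
    so these balls are strong neighbourhoods. *)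
Lemma dual_generated : generated_by
  [set (fun F : Y => dual_seminorm Xk nu k F) | k in [set k | (0 < k)%N]].
Proof.
split.
- by move=> _ [k k0 <-]; exact: dual_seminormP.
- move=> F F0; apply: dual_seminorm_eq0 => k k0.
  by apply: (F0 (fun G : Y => dual_seminorm Xk nu k G)); exists k.
move=> F U; split.
  (* The convergence to [F] of the filter of seminorm balls says that each strong neighbourhood
     contains such a ball. *)
  pose N := filter_from [set kr : nat * R | (0 < kr.1)%N /\ 0 < kr.2]
    (fun kr => [set G : Y | dual_seminorm Xk nu kr.1 (G - F) <= kr.2]).
  have NF : Filter N.
    apply: filter_from_filter; first by exists (1%N, 1).
    move=> [k r] [l s] [k0 r0] [l0 s0]; rewrite /= in k0 r0 l0 s0.
    exists (maxn k l, Num.min r s); first by rewrite /= leq_max k0 lt_min r0.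
    move=> G GF.
    have : dual_seminorm Xk nu (maxn k l) (G - F : Y) <= Num.min r s by exact: GF.
    rewrite le_min => /andP[Gr Gs]; split.
      by apply: le_trans _ Gr; apply: dual_seminorm_mono; rewrite ?leq_maxl.
    by apply: le_trans _ Gs; apply: dual_seminorm_mono; rewrite ?leq_maxr.
  have NcF : N --> F.
    apply/cvg_dualP => B bB e e0.
    have [k k0 BC] := bounded_sub_level_set p_gen Xk_mono Xk_sub Xk_closed
      nu_norm nu_lsc bB.
    exists (k, e / 2 / k%:R); first by rewrite /= k0 !divr_gt0// ltr0n.
    move=> G GF u Bu; have := dual_seminorm_level (G - F) k0 (BC _ Bu).
    rewrite (_ : (G - F : Y) u = G u - F u)// distrC => h.
    apply: le_lt_trans h _; apply: (@le_lt_trans _ _ (e / 2)); last by lra.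
    by rewrite -ler_pdivlMr ?ltr0n//; exact: GF.
  move=> /NcF[[k r] [k0 r0] sU]; rewrite /= in k0 r0.
  exists 1%N, (fun=> fun F : Y => dual_seminorm Xk nu k F), (fun=> r); split=> //.
    by move=> _; exists k.
  by move=> G Gr; apply: sU; exact: (Gr ord0).
move=> [n [pm [r [Ppm r0 sU]]]].
have FF : Filter (nbhs F) := nbhs_filter F.
suff : \forall G \near F, forall m, pm m (G - F) <= r m.
  by apply: filterS => G Gr; apply: sU => m _ /=.
refine (@filter_forall Y _ (fun m => [set G : Y | pm m (G - F) <= r m]) _ FF _).
move=> m; have [k k0 <-] := Ppm m.
have /cvg_dualP hF : nbhs F --> F by [].
have := hF _ (level_set_bounded p_gen Xk_sub nu_norm C_compact k0) _ (r0 m).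
apply: filterS => G GF; apply: ge_sup.
  by case: (unit_ball_has_sup (G - F) k0).
move=> _ [u [Xu nuu] <-]; rewrite (_ : (G - F : Y) u = G u - F u)// distrC.
by rewrite ltW// GF//; split=> //=; rewrite (le_trans nuu)// ler1n.
Qed.

(** The limit is built pointwise. Convergence is uniform on each level set, so the limit is
    continuous there, hence for the localized topology. *)
Lemma dual_complete : linear_complete Y.
Proof.
move=> N PN cN.
have small k (e : R) : (0 < k)%N -> 0 < e -> exists2 A : set Y, N A &
    forall G G', A G -> A G' -> forall u, Xk k u -> `|G u - G' u| <= e * nu u.
  move=> k0 e0.
  have [A NA hA] := cN _ (mono_near dual_generated 0 k0 e0).
  exists A => // G G' AG AG' u Xu; have /= := hA _ _ AG AG'; rewrite subr0 => h.
  apply: le_trans (dual_seminorm_bound (G - G') k0 Xu) _.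
  by rewrite ler_wpM2r ?(seminorm_ge0 nu_sn)// ltW.
have /choice[L LP] : forall u, exists l : R^o, (fun G : Y => G u) @ N --> l.
  move=> u; have [k k0 Xu] := Xk_ex Xk_cover u.
  suff : cvg ((fun G : Y => G u) @ N) by move=> /cvg_ex.
  apply: cauchy_cvg; apply: cauchy_exP => e e0.
  have nu1 : 0 < nu u + 1 by rewrite ltr_wpDl// (seminorm_ge0 nu_sn).
  have [||A NA hA] := small k (e / (nu u + 1)) => //; first by rewrite divr_gt0.
  have [G AG] := filter_ex NA; exists (G u).
  suff : N [set G' | ball (G u : R^o) e (G' u)] by [].
  apply: filterS NA => G' AG'; rewrite -ball_normE/=.
  apply: le_lt_trans (hA _ _ AG AG' _ Xu) _.
  by rewrite mulrAC ltr_pdivrMr// ltr_pM2l// ltrDl.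
have Llin : linear (L : X -> R^o).
  move=> a x y; have PN' : ProperFilter ((fun G : Y => G (a *: x + y)) @ N).
    exact: fmap_proper_filter.
  apply: (@cvg_unique R^o _ _ PN' _ _ (LP _)); first exact: norm_hausdorff.
  rewrite (_ : (fun G : Y => _) = (fun G : Y => a * G x + G y)); last first.
    by apply/funext => G; rewrite dualD dualZ.
  by apply: (@cvgD _ R^o); [apply: (@cvgMr R) | ]; exact: LP.
(* The set [A] is fixed before [u]: only [G'] is chosen for a given [u], close to the limit at that
   point. *)
have LN k (e : R) : (0 < k)%N -> 0 < e -> exists2 A : set Y, N A &
    forall G, A G -> forall u, Xk k u -> `|G u - L u| <= e * nu u.
  move=> k0 e0; have [A NA hA] := small k e k0 e0; exists A => // G AG u Xu.
  apply/ler_addgt0Pr => c c0.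
  have /cvgrPdist_lt/(_ c c0) hc := LP u.
  have [G' [AG' /= hG']] := filter_ex (filterI NA hc).
  rewrite (le_trans (ler_distD (G' u) _ _))// lerD//; first exact: hA.
  by rewrite distrC ltW.
have Lc : continuous (L : LX -> R^o).
  apply: localization_continuous => [x y t _ _|_ x e [k k0 <-] Cx e0].
    have L0 : L 0 = 0.
      by have := Llin (-1) 0 0; rewrite scaler0 addr0 scaleN1r addNr.
    rewrite Llin; congr (_ + _).
    by have := Llin (1 - t) y 0; rewrite L0 !addr0.
  have kR : 0 < (k%:R : R) by rewrite ltr0n.
  have [||A NA hA] := LN k (e / 4 / k%:R) => //; first by rewrite !divr_gt0.
  have [G AG] := filter_ex NA.
  have e2 : 0 < e / 2 by lra.
  have hG u : level_set Xk nu k u -> `|G u - L u| <= e / 4.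
    move=> [Xu nuu]; apply: le_trans (hA _ AG _ Xu) _.
    by rewrite mulrAC ler_pdivrMr// ler_wpM2l//; lra.
  have := localization_continuousP (dual_continuous (F := G))
    (level_setsP Xk nu k0) Cx e2.
  apply: filterS => y h Cy; have := h Cy; have := hG _ Cx; have := hG _ Cy.
  have := ler_distD (G x) (L x) (L y); have := ler_distD (G y) (G x) (L y).
  by rewrite (distrC (L x) (G x)); lra.
have Lin : (L : LX -> R^o) \in @continuous_form R LX by apply/asboolP.
exists (StrongDual Lin); apply/cvg_dualP => B bB e e0.
have [k k0 BC] := bounded_sub_level_set p_gen Xk_mono Xk_sub Xk_closed
  nu_norm nu_lsc bB.
have kR : 0 < (k%:R : R) by rewrite ltr0n.
have [||A NA hA] := LN k (e / 2 / k%:R) => //; first by rewrite !divr_gt0.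
apply: filterS NA => G AG u /BC[Xu nuu]; rewrite distrC.
apply: le_lt_trans (hA _ AG _ Xu) _; apply: (@le_lt_trans _ _ (e / 2)); last by lra.
by rewrite mulrAC ler_pdivrMr// ler_wpM2l//; lra.
Qed.

Lemma dual_frechet : frechet_space Y.
Proof.
have mono := fun k l (F : Y) => @dual_seminorm_mono k l F.
split; last exact: dual_complete.
- exact: mono_locally_convex mono dual_generated.
- exact: mono_metrizable mono dual_generated.
Qed.

End Dual.

(** * The operator *)

Lemma near_lt_cvg (R : realType) (T : Type) (N : set_system T) {FN : Filter N}
    (f g : T -> R^o) (a b : R) : f @ N --> (a : R^o) -> g @ N --> (b : R^o) ->
  a < b -> \forall x \near N, f x < g x.
Proof.
move=> fa gb ab; have e0 : 0 < (b - a) / 2 by lra.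
have /cvgrPdist_lt/(_ _ e0) hf := fa; have /cvgrPdist_lt/(_ _ e0) hg := gb.
apply: filterS2 hf hg => x; rewrite !ltr_distl => /andP[h1 h2] /andP[h3 h4].
lra.
Qed.

Section Operator.
Context (R : realType) (E : tvsType R) (q : nat -> E -> R).
Context (q_mono : forall k l v, (0 < k)%N -> (k <= l)%N -> q k v <= q l v).
Context (q_gen : generated_by (q @` [set k | (0 < k)%N])).
Context (X : tvsType R) (I : Type) (p : I -> X -> R).
Context (p_gen : generated_by (range p)).
Context (Xk : nat -> set X).
Context (Xk_mono : forall k l, (0 < k)%N -> (k <= l)%N -> Xk k `<=` Xk l).
Context (Xk_sub : forall k, (0 < k)%N -> submod_closed (mem (Xk k))).
Context (Xk_closed : forall k, (0 < k)%N -> closed (Xk k)).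
Context (Xk_cover : \bigcup_(k in [set k | (0 < k)%N]) Xk k = [set: X]).
Context (nu : X -> R) (nu_norm : is_norm nu).
Context (nu_lsc : lower_semicontinuous (fun u => (nu u)%:E)).
Context (C_compact : forall k, (0 < k)%N -> compact (level_set Xk nu k)).
Context (D : E -> {linear X -> R^o}).
Context (D_linear : linear (fun v => D v : X -> R^o)).
Context (D_F : forall (v : E) (eps : R), 0 < eps ->
     exists i, exists2 theta : R, 0 < theta &
       forall u, Xk `|Num.ceil eps^-1|%N u ->
         `|D v u| <= theta * p i u + eps * nu u).
Context (cG : nat -> R) (cG_gt0 : forall k, (0 < k)%N -> 0 < cG k).
Context (D_G : forall k u v, (0 < k)%N -> Xk k u ->
     `|D v u| <= cG k * nu u * q k v).
Context (cH : nat -> R) (cH_gt0 : forall k, (0 < k)%N -> 0 < cH k).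
Context (D_H : forall k u, (0 < k)%N -> Xk k u ->
     nu u <= cH k * sup [set `|D v u| | v in [set v | q k v <= 1]]).
Context (D_I : forall k u, (0 < k)%N -> ~ Xk k u ->
     exists2 v, D v u != 0 & q k v = 0).

Let nu_sn : is_seminorm nu. Proof. by have [] := nu_norm. Qed.

Let q_sn k : (0 < k)%N -> is_seminorm (q k).
Proof. by move=> k0; exact: mono_seminorm q_gen _ k0. Qed.

Local Notation LX := (localization (level_sets Xk nu)).
Local Notation Y := (localized_dual Xk nu).

Let DDZ a v w u : D (a *: v + w) u = a * D v u + D w u.
Proof. by rewrite D_linear. Qed.

Let D0 u : D 0 u = 0.
Proof. by have := DDZ (-1) 0 0 u; rewrite scaler0 addr0 mulN1r addNr. Qed.

Let DZ a v u : D (a *: v) u = a * D v u.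
Proof. by have := DDZ a v 0 u; rewrite !addr0 D0 addr0. Qed.

Lemma operator_in_dual v : (D v : LX -> R^o) \in @continuous_form R LX.
Proof.
apply/asboolP; split; first exact: linearP.
apply: localization_continuous => [x y t _ _|_ x e [k k0 <-] Cx e0].
  by rewrite linearD !linearZ.
have kR : 0 < (k%:R : R) by rewrite ltr0n.
(* The first entry places [Xk k] inside the subspace to which (F) applies; the second makes
   [eps * nu (x - y)] at most [e / 4], as [nu (x - y) <= 2 * k%:R]. *)
pose eps := Num.min k%:R^-1 (e / (8 * k%:R)).
have eps0 : 0 < eps by rewrite lt_min invr_gt0 kR divr_gt0// mulr_gt0.
have [i [theta th0 hD]] := D_F v eps0.
have kn : (k <= `|Num.ceil eps^-1|%N)%N.
  rewrite -(ler_nat R) natr_absz ger0_norm; last first.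
    by rewrite -(ler_int R) (le_trans _ (ceil_ge _))// invr_ge0 ltW.
  apply: le_trans (ceil_ge _); rewrite -[leLHS]invrK lef_pV2 ?posrE ?invr_gt0//.
  by rewrite /eps ge_min lexx.
have r0 : 0 < e / 2 / theta by rewrite !divr_gt0.
have psn : is_seminorm (p i) by have [h _ _] := p_gen; apply: h; exists i.
have := generated_near x p_gen (imageT p i) r0.
apply: filterS => y; rewrite ltr_pdivlMr// mulrC => hy Cy.
have -> : D v x - D v y = D v (x - y) by rewrite linearB.
have [Xx nx] := Cx; have [Xy ny] := Cy; rewrite /= in nx ny.
have /hD h : Xk `|Num.ceil eps^-1|%N (x - y).
  by apply: Xk_mono kn _ _ => //; exact: XkB.
apply: le_lt_trans h _; rewrite (seminormBC psn).
have nxy : nu (x - y) <= 2 * k%:R.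
  apply: le_trans (seminormD nu_sn _ _) _; rewrite (seminormN nu_sn); lra.
have : eps * nu (x - y) <= e / (8 * k%:R) * (2 * k%:R).
  apply: ler_pM => //; [exact: ltW|exact: seminorm_ge0|].
  by rewrite ge_min lexx orbT.
have -> : e / (8 * k%:R) * (2 * k%:R) = e / 4 by field; rewrite gt_eqF.
by lra.
Qed.

Lemma operator_linear :
  exists DD : {linear E -> Y}, forall v u, DD v u = D v u.
Proof.
pose f v : Y := StrongDual (operator_in_dual v).
have fl : linear f by move=> a v w; apply: val_inj; exact: D_linear.
pose DD : {linear E -> Y} := HB.pack f (GRing.isLinear.Build R E Y *:%R f fl).
by exists DD.
Qed.

Context (DD : {linear E -> Y}) (DDE : forall v u, DD v u = D v u).

Lemma operator_bound k v : (0 < k)%N ->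
  dual_seminorm Xk nu k (DD v) <= cG k * q k v.
Proof.
move=> k0; apply: (dual_seminorm_le p_gen Xk_sub nu_norm C_compact) => //.
  by rewrite mulr_ge0 ?(ltW (cG_gt0 k0))// (seminorm_ge0 (q_sn k0)).
by move=> u Xu; rewrite DDE mulrAC; exact: D_G.
Qed.

Lemma operator_continuous : continuous DD.
Proof.
move=> v U.
have mono := fun k l (F : Y) => @dual_seminorm_mono R X I p p_gen Xk Xk_mono
  Xk_sub nu nu_norm C_compact k l F.
have gen := dual_generated p_gen Xk_mono Xk_sub Xk_closed Xk_cover nu_norm
  nu_lsc C_compact.
move=> /(mono_nbhsP mono gen)[k [r [k0 r0] sU]].
have c0 := cG_gt0 k0.
have : \forall w \near v, q k (w - v) < r / cG k.
  by apply: (mono_near q_gen) => //; rewrite divr_gt0.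
apply: filterS => w; rewrite ltr_pdivlMr// mulrC => h; apply: sU.
by apply: le_lt_trans h; rewrite -linearB; exact: operator_bound.
Qed.

(* On X_k this is the lower bound (H); outside X_k, (I) makes the infimum of
   G u - D v u over the q_k-ball equal to -oo. *)
Lemma operator_approx_at k (G : Y) (r eta : R) u : (0 < k)%N -> 0 < r ->
  dual_seminorm Xk nu k G <= r -> 0 < eta ->
  exists2 v, q k v <= cH k * r & G u - D v u <= eta.
Proof.
move=> k0 r0 Gr eta0; have c0 := cH_gt0 k0; have sq := q_sn k0.
have cr : 0 < cH k * r by rewrite mulr_gt0.
have [Xu|nXu] := pselect (Xk k u); last first.
  have [v Dv qv] := D_I k0 nXu; exists (G u / D v u *: v).
    by rewrite (seminormZ sq) qv mulr0 ltW.
  by rewrite DZ divfK// subrr ltW.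
pose S := [set `|D v u| | v in [set v | q k v <= 1]].
have hS : has_sup S.
  split; first by exists `|D 0 u|; exists 0 => //=; rewrite (seminorm0 sq).
  exists (cG k * nu u) => _ [v qv <-]; apply: le_trans (D_G _ k0 Xu) _.
  by rewrite ler_piMr// mulr_ge0 ?(seminorm_ge0 nu_sn)// ltW// cG_gt0.
(* The defect allowed in the supremum of (H); scaling by [cH k * r] turns it into [eta]. *)
have e0 : 0 < eta / (cH k * r) by rewrite divr_gt0.
have [_ [v /= qv <-]] := sup_adherent e0 hS.
rewrite ltrBlDr => hv.
pose t := if 0 <= D v u then cH k * r else - (cH k * r).
have tE : `|t| = cH k * r.
  by rewrite /t; case: ifP => _; rewrite ?normrN gtr0_norm.
have tD : t * D v u = cH k * r * `|D v u|.
  rewrite /t; have [h|h] := leP 0 (D v u); first by rewrite ger0_norm.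
  by rewrite ltr0_norm// mulrN mulNr.
exists (t *: v); first by rewrite (seminormZ sq) tE ler_piMr// ltW.
rewrite DZ tD lerBlDr.
have hG := dual_seminorm_bound p_gen Xk_sub nu_norm C_compact G k0 Xu.
apply: le_trans (ler_norm _) _; apply: le_trans hG _.
have hnu : nu u <= cH k * sup S := D_H k0 Xu.
apply: (@le_trans _ _ (r * (cH k * sup S))).
  apply: ler_pM => //; last exact: seminorm_ge0.
  exact: (dual_seminorm_ge0 p_gen Xk_sub nu_norm C_compact).
have -> : r * (cH k * sup S) = cH k * r * sup S by ring.
have -> : eta + cH k * r * `|D v u| = cH k * r * (`|D v u| + eta / (cH k * r)).
  by field; rewrite !gt_eqF.
by rewrite ler_pM2l// ltW.
Qed.

(* Minimax over the compact level set, against the q_k-ball of E. *)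
Lemma operator_approx k l (G : Y) (r eta : R) : (0 < k)%N -> (0 < l)%N ->
  0 < r -> dual_seminorm Xk nu k G <= r -> 0 < eta ->
  exists2 v, q k v <= cH k * r & dual_seminorm Xk nu l (G - DD v) <= eta.
Proof.
move=> k0 l0 r0 Gr eta0; have c0 := cH_gt0 k0; have sq := q_sn k0.
have cr : 0 < cH k * r by rewrite mulr_gt0.
pose K := [set v | q k v <= cH k * r].
(* Pointwise solutions err by [eta / 4], which leaves an open condition at [eta / 2]; minimax loses
   the other [eta / 2]. *)
have eta4 : 0 < eta / 4 by lra.
have /choice[W WP] : forall v, exists W : set X, open W /\
    [set u | G u - D v u < eta / 2] `&` level_set Xk nu l =
    W `&` level_set Xk nu l.
  move=> v; have oU : localization_open (level_sets Xk nu)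
      [set u | (G - DD v) u < eta / 2].
    have cf := dual_continuous (F := G - DD v).
    suff : open [set u : LX | (G - DD v) u < eta / 2] by [].
    by have /continuousP/(_ _ (@open_lt R _)) := cf; exact.
  have [W oW hW] := localization_trace oU (level_setsP Xk nu l0).
  exists W; split => //; rewrite -hW; congr (_ `&` _).
  by apply/seteqP; split => u /=; rewrite -DDE.
(* Finite subsets of [K] directed by inclusion: compactness in its near-covering form then yields
   one finite [s] for the whole level set. *)
pose N := filter_from [set s : seq E | forall v, v \in s -> K v]
  (fun s => [set s' : seq E | {subset s <= s'}]).
have NF : Filter N.
  apply: filter_from_filter; first by exists [::].
  move=> s1 s2 K1 K2; exists (s1 ++ s2).
    by move=> v; rewrite mem_cat => /orP[/K1|/K2].
  by move=> s' hs; split=> v vs; apply: hs; rewrite mem_cat vs ?orbT.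
have /compact_near_coveringP/(_ _ N (fun s u => level_set Xk nu l u ->
    exists2 v, v \in s & G u - D v u - eta / 2 <= 0)) := C_compact l0.
move=> /(_ NF)[u Cu|s sK sC].
  have [v Kv hv] := operator_approx_at u k0 r0 Gr eta4.
  have [oW WE] := WP v.
  have [Wu _] : (W v `&` level_set Xk nu l) u.
    by rewrite -WE; split => //=; lra.
  exists (W v, [set s : seq E | v \in s]); first split => /=.
  - exact: open_nbhs_nbhs.
  - exists [:: v]; first by move=> w; rewrite inE => /eqP ->.
    by move=> s /(_ v); apply; rewrite inE.
  move=> [u' s] /= [Wu' vs] Cu'; exists v => //.
  have [/= h _] : ([set u | G u - D v u < eta / 2] `&` level_set Xk nu l) u'.
    by rewrite WE.
  lra.
have cK : convex_closed K.
  move=> v w t t0 t1 Kv Kw.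
  by apply: le_trans (seminorm_conv sq _ _ t0 t1) _; exact: convr_le.
have K0 : K !=set0 by exists 0; rewrite /K/= (seminorm0 sq) ltW.
have eta2 : 0 < eta / 2 by lra.
have [|||v Kv hv] := @finite_minimax R X E K
    (fun u v => G u - D v u - eta / 2) (level_set Xk nu l) s cK K0 _ _
    (level_set_convex Xk_sub nu_norm l0) sK _ _ eta2.
- move=> v x y t t0 t1.
  have -> : D v (t *: x + (1 - t) *: y) = t * D v x + (1 - t) * D v y.
    by rewrite linearP linearZ.
  by rewrite dualD !dualZ; ring.
- by move=> u x y t t0 t1; rewrite DDZ DZ; ring.
- by move=> u Cu; apply: sC (Cu) => // v.
exists v => //; apply: ge_sup.
  by case: (unit_ball_has_sup p_gen Xk_sub nu_norm C_compact (G - DD v) l0).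
move=> _ [u [Xu nuu] <-]; rewrite (_ : (G - DD v : Y) u = G u - D v u); last first.
  by rewrite -DDE.
have Cu : level_set Xk nu l u.
  by split=> //=; rewrite (le_trans nuu)// ler1n.
(* Minimax gives an upper bound only; its value at [- u] supplies the lower bound. *)
have CNu : level_set Xk nu l (- u).
  split; first by rewrite -scaleN1r; exact: XkZ.
  by rewrite /= (seminormN nu_sn); case: Cu.
have := hv _ Cu; have := hv _ CNu; rewrite dualN linearN ler_norml => h1 h2.
by apply/andP; split; lra.
Qed.

End Operator.

(** * Continuous right inverses *)

Section BartleGraves.
Context (R : realType) (E : tvsType R) (q : nat -> E -> R).
Context (q_mono : forall k l v, (0 < k)%N -> (k <= l)%N -> q k v <= q l v).
Context (q_gen : generated_by (q @` [set k | (0 < k)%N])).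
Context (E_complete : linear_complete E).
Context (Y : preTopologicalLmodType R) (s : nat -> Y -> R).
Context (s_mono : forall k l F, (0 < k)%N -> (k <= l)%N -> s k F <= s l F).
Context (s_gen : generated_by (s @` [set k | (0 < k)%N])).
Context (L : {linear E -> Y}).
Context (cG : nat -> R) (cG_gt0 : forall k, (0 < k)%N -> 0 < cG k).
Context (L_bound : forall k v, (0 < k)%N -> s k (L v) <= cG k * q k v).
Context (cH : nat -> R) (cH_gt0 : forall k, (0 < k)%N -> 0 < cH k).
Context (L_approx : forall k l (G : Y) (r eta : R), (0 < k)%N -> (0 < l)%N ->
  0 < r -> s k G <= r -> 0 < eta ->
  exists2 v, q k v <= cH k * r & s l (G - L v) <= eta).

Let q_sn k : (0 < k)%N -> is_seminorm (q k).
Proof. by move=> k0; exact: mono_seminorm q_gen _ k0. Qed.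

Let s_sn k : (0 < k)%N -> is_seminorm (s k).
Proof. by move=> k0; exact: mono_seminorm s_gen _ k0. Qed.

Let s_cont k F : (0 < k)%N -> s k G @[G --> F] --> (s k F : R^o).
Proof.
by move=> k0; apply: (generated_continuous s_gen); exists k.
Qed.

(** Needed for the openness of the lower sections to which continuous selection is applied. *)
Lemma residual_cvg k (J : Y -> E) (F : Y) (v : E) : (0 < k)%N ->
  {for F, continuous J} ->
  s k (G - L (J G) - L v) @[G --> F] --> (s k (F - L (J F) - L v) : R^o).
Proof.
move=> k0 cJ; apply/cvgrPdist_lt => e e0.
have c0 := cG_gt0 k0; have ss := s_sn k0.
have e2 : 0 < e / 2 by lra.
have e2c : 0 < e / 2 / cG k by rewrite divr_gt0.
have nJ : \forall G \near F, q k (J G - J F) < e / 2 / cG k.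
  exact: cJ (mono_near q_gen (J F) k0 e2c).
have nF := mono_near s_gen F k0 e2.
apply: filterS2 nF nJ => G sGF; rewrite ltr_pdivlMr// mulrC => qGF.
rewrite distrC; apply: le_lt_trans (seminorm_dist ss _ _) _.
have -> : G - L (J G) - L v - (F - L (J F) - L v) = (G - F) - L (J G - J F).
  rewrite (linearB L) !opprB addrA subrK addrACA [RHS]addrACA.
  by rewrite [- L (J G) + _]addrC.
apply: le_lt_trans (seminormD ss _ _) _; rewrite (seminormN ss).
by have := L_bound (J G - J F) k0; lra.
Qed.

(** One correction: [J'] adds to [J] a continuous selection of approximate solutions for the
    residual. Bounds are relative to [s k F], which is continuous in [F], so they are open
    conditions. *)
Lemma selection_step k n m (c c' : R) (J : Y -> E) :
  (0 < k)%N -> (0 < n)%N -> (0 < m)%N -> 0 < c -> 0 < c' ->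
  (forall F, 0 < s k F -> {for F, continuous J} /\
     s n (F - L (J F)) < c * s k F) ->
  exists J' : Y -> E, forall F, 0 < s k F ->
    [/\ {for F, continuous J'}, s m (F - L (J' F)) < c' * s k F &
        q n (J' F - J F) <= cH n * c * s k F].
Proof.
move=> k0 n0 m0 c0 c'0 JP.
pose Phi (F : Y) := [set v : E | [/\ 0 < s k F, q n v < cH n * c * s k F &
  s m (F - L (J F) - L v) < c' * s k F]].
have hH := cH_gt0 n0.
have [d [dxx _ dC dD dnbhs]] := mono_metrizable s_mono s_gen.
have [||g gP] := @metric_selection R Y d E Phi dxx dC dD dnbhs.
- move=> F v w t t0 t1 [F0 qv sv] [_ qw sw]; split=> //.
    by apply: le_lt_trans (seminorm_conv (q_sn n0) _ _ t0 t1) _; exact: convr_lt.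
  move: (F - L (J F)) sv sw => G sv sw.
  have -> : G - L (t *: v + (1 - t) *: w) =
      t *: (G - L v) + (1 - t) *: (G - L w).
    have -> : L (t *: v + (1 - t) *: w) = t *: L v + (1 - t) *: L w.
      by rewrite linearP linearZ.
    by rewrite !scalerBr addrACA -opprD -scalerDl [t + _]addrC subrK scale1r.
  by apply: le_lt_trans (seminorm_conv (s_sn m0) _ _ t0 t1) _; exact: convr_lt.
- move=> F v [F0 qv sv]; have [cJ _] := JP _ F0.
  have sF := @s_cont k F k0.
  have sF' (a : R) : a * s k G @[G --> F] --> (a * s k F : R^o).
    by apply: (@cvgMr R).
  have N1 : \forall G \near F, 0 < s k G.
    by apply: near_lt_cvg sF F0; exact: cvg_cst.
  have N2 : \forall G \near F, q n v < cH n * c * s k G.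
    by apply: near_lt_cvg (sF' _) qv; exact: cvg_cst.
  have N3 : \forall G \near F, s m (G - L (J G) - L v) < c' * s k G.
    by apply: near_lt_cvg _ (sF' _) sv; exact: residual_cvg.
  by apply: filterS3 N1 N2 N3 => G *; split.
exists (fun F => J F + g F) => F F0.
have [cJ sJ] := JP _ F0.
have [|[_ qg sg] cg] := gP F.
  have cs : 0 < c * s k F by rewrite mulr_gt0.
  have c's : 0 < c' * s k F by rewrite mulr_gt0.
  have s0 := seminorm_ge0 (s_sn n0) (F - L (J F)).
  (* The midpoint is positive and turns the weak bound of [L_approx] into the strict one of
     [Phi]. *)
  pose r := (s n (F - L (J F)) + c * s k F) / 2.
  have r0 : 0 < r by rewrite /r; lra.
  have sr : s n (F - L (J F)) <= r by rewrite /r; lra.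
  have eta0 : 0 < c' * s k F / 2 by lra.
  have [v qv sv] := L_approx n0 m0 r0 sr eta0.
  exists v; split => //; last by lra.
  by apply: le_lt_trans qv _; rewrite -mulrA ltr_pM2l// /r; lra.
split.
- apply: (@continuous2_cvg _ E E E _ _ _ _ (fun a b => a + b)) cJ cg.
  exact: (@add_continuous E (_, _)).
- by rewrite (linearD L) opprD addrA.
- by rewrite addrAC subrr add0r ltW.
Qed.

(** * Summation of the successive corrections *)

Section Iteration.
Context (k : nat) (eps : R) (k_gt0 : (0 < k)%N) (eps_gt0 : 0 < eps).

(** The budget for the first [n] corrections, in units of [cH k * s k F]: it starts at 0, jumps to
    [1 + eps / 2] and increases towards [1 + eps]. *)
Let T (n : nat) : R := if n is _.+1 then 1 + eps - eps / n.+1%:R else 0.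

Let Tgap n : (0 < n)%N -> T n = 1 + eps - eps / n.+1%:R.
Proof. by case: n. Qed.

Let T_le n : T n <= 1 + eps.
Proof.
rewrite /T; case: n => [|n] /=; first by rewrite addr_ge0 ?ltW.
by rewrite gerBl divr_ge0 ?ler0n// ltW.
Qed.

Let T_lt n : T n < T n.+1.
Proof.
rewrite /T; case: n => [|n] /=; first by have := eps_gt0; lra.
by rewrite ltrD2l ltrN2 ltr_pM2l// ltf_pV2 ?posrE// ltr_nat.
Qed.

(* The last factor makes the residuals vanish even if [cH] tends to 0. *)
Let a (n : nat) : R :=
  Num.min (cH k / cH (k + n) * (T n.+1 - T n)) (2 / n.+1%:R).

Let kn_gt0 n : (0 < k + n)%N. Proof. by rewrite addn_gt0 k_gt0. Qed.

Let a_gt0 n : 0 < a n.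
Proof.
rewrite lt_min; apply/andP; split; last by rewrite divr_gt0.
by rewrite mulr_gt0 ?divr_gt0 ?cH_gt0// subr_gt0.
Qed.

Let a_le n : cH (k + n) * a n <= cH k * (T n.+1 - T n).
Proof.
apply: (@le_trans _ _ (cH (k + n) * (cH k / cH (k + n) * (T n.+1 - T n)))).
  by rewrite ler_wpM2l ?ge_min ?lexx// ltW// cH_gt0.
by rewrite mulrA mulrCA divff ?mulr1// gt_eqF// cH_gt0.
Qed.

(** The iteration starts from the zero map, whose residual is [F] itself; the strict bound on it
    asks for a factor above 1. *)
Let a0 : 1 < a 0.
Proof.
rewrite lt_min addn0 divff ?gt_eqF ?cH_gt0// mul1r/=.
by apply/andP; split; have := eps_gt0; lra.
Qed.

Lemma approximate_sections : exists J : nat -> Y -> E,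
  forall F, 0 < s k F ->
  [/\ J 0 F = 0, forall n, {for F, continuous (J n)},
      forall n, s (k + n) (F - L (J n F)) < a n * s k F &
      forall n, q (k + n) (J n.+1 F - J n F) <= cH (k + n) * a n * s k F].
Proof.
pose P n (J : Y -> E) := forall F, 0 < s k F ->
  {for F, continuous J} /\ s (k + n) (F - L (J F)) < a n * s k F.
(* With [P] as a premise, the choice ranges over all pairs; [J] is then defined by plain recursion
   and its invariant proved afterwards. *)
have /choice[next nextP] : forall nJ : nat * (Y -> E), exists J' : Y -> E,
    P nJ.1 nJ.2 -> P nJ.1.+1 J' /\ forall F, 0 < s k F ->
      q (k + nJ.1) (J' F - nJ.2 F) <= cH (k + nJ.1) * a nJ.1 * s k F.
  move=> [n J]; have [PJ|nP] := pselect (P n J); last by exists J.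
  have [J' J'P] := selection_step k_gt0 (kn_gt0 n) (kn_gt0 n.+1)
    (a_gt0 n) (a_gt0 n.+1) PJ.
  exists J' => _; split=> [F /J'P[]//|F /J'P[]//].
pose J := fix J n := if n is n'.+1 then next (n', J n') else fun=> 0 : E.
have PJ n : P n (J n).
  elim: n => [F F0|n IH] /=; last by have [] := nextP (n, J n) IH.
  split; first exact: cvg_cst.
  by rewrite (linear0 L) subr0 addn0 ltr_pMl.
exists J => F F0; split=> // n; first by have [] := PJ n F F0.
  by have [] := PJ n F F0.
by have [_] := nextP (n, J n) (PJ n); apply.
Qed.

Lemma bounded_continuous_section : exists J : Y -> E, forall F, 0 < s k F ->
  [/\ L (J F) = F, {for F, continuous J} &
      q k (J F) <= (1 + eps) * cH k * s k F].
Proof.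
have [J JP] := approximate_sections.
have cH0 := cH_gt0 k_gt0.
(* Telescoping: from step [m] on, each correction is measured by a seminorm above [q (k + m)], and
   [a_le] bounds it by an increment of [T]. *)
have Jmn F m n : 0 < s k F -> (m <= n)%N ->
    q (k + m) (J n F - J m F) <= cH k * (T n - T m) * s k F.
  move=> F0 mn; have [_ _ _ hq] := JP _ F0.
  rewrite -(subnKC mn); elim: (n - m)%N => [|j IH].
    by rewrite addn0 !subrr mulr0 mul0r (seminorm0 (q_sn (kn_gt0 m))).
  apply: le_trans (seminormBD (q_sn (kn_gt0 m)) (J (m + j)%N F) _ _) _.
  rewrite addnS (_ : T _ - T m = (T (m + j).+1 - T (m + j)) + (T (m + j) - T m)).
    rewrite mulrDr mulrDl lerD//.
    apply: (@le_trans _ _ (q (k + (m + j)) (J (m + j).+1 F - J (m + j)%N F))).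
      by apply: q_mono => //; rewrite leq_add2l leq_addr.
    by apply: le_trans (hq _) _; rewrite ler_wpM2r// ltW.
  by rewrite addrA subrK.
(* The first quantity controls the tail of the series, the second the residual of the equation. *)
have small (c : R) : 0 < c -> exists m0 : nat, forall m, (m0 <= m)%N ->
    cH k * (1 + eps - T m) < c /\ a m < c.
  move=> c0; pose M := Num.max (cH k * eps / c) (2 / c).
  exists (Num.truncn M).+1 => m hm; rewrite (Tgap (leq_ltn_trans (leq0n _) hm)).
  have Mm : M < m.+1%:R by rewrite (lt_trans (truncnS_gt M))// ltr_nat.
  move: Mm; rewrite gt_max !ltr_pdivrMr// => /andP[h1 h2]; split.
    by rewrite subKr mulrA ltr_pdivrMr// [c * _]mulrC.
  by rewrite /a gt_min; apply/orP; right; rewrite ltr_pdivrMr// mulrC.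
have /choice[j jP] : forall F, exists l : E, 0 < s k F ->
    forall m, q (k + m) (l - J m F) <= cH k * (1 + eps - T m) * s k F.
  move=> F; have [F0|] := ltP 0 (s k F); last by exists 0.
  have [|l lP] := E_complete (F := (fun n => J n F) @ \oo).
    move=> U /(mono_nbhsP q_mono q_gen)[l [r [l0 r0] sU]].
    have e0 : 0 < r / 2 / s k F by rewrite !divr_gt0.
    have [m0 hm0] := small _ e0; pose m := maxn l m0.
    exists [set v | q (k + m) (v - J m F) < r / 2].
      exists m => // n /= mn; apply: le_lt_trans (Jmn _ _ _ F0 mn) _.
      rewrite -ltr_pdivlMr//; have [] := hm0 m (leq_maxr _ _) => h _.
      by apply: le_lt_trans h; rewrite ler_wpM2l ?(ltW cH0)// lerD2r T_le.
    move=> v w /= qv qw; apply: sU; rewrite /= subr0.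
    apply: (@le_lt_trans _ _ (q (k + m) (v - w))).
      apply: q_mono => //; rewrite (leq_trans (leq_maxl l m0))// leq_addl//.
    apply: le_lt_trans (seminormBD (q_sn (kn_gt0 m)) (J m F) _ _) _.
    by rewrite [q _ (J m F - w)](seminormBC (q_sn (kn_gt0 m))) (splitr r) ltrD.
  exists l => _ m; apply/ler_addgt0Pr => c c0.
  have nl : \forall n \near \oo, q (k + m) (J n F - l) < c.
    exact: lP (mono_near q_gen l (kn_gt0 m) c0).
  have [n [mn hn]] := filter_ex (filterI (nbhs_infty_ge m) nl).
  apply: le_trans (seminormBD (q_sn (kn_gt0 m)) (J n F) _ _) _.
  rewrite addrC lerD//; last first.
    by rewrite (seminormBC (q_sn (kn_gt0 m))) ltW.
  apply: le_trans (Jmn _ _ _ F0 mn) _.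
  by rewrite ler_wpM2r ?(ltW F0)// ler_wpM2l ?(ltW cH0)// lerD2r T_le.
exists j => F F0; have [J0 Jc Js Jq] := JP _ F0; split.
- apply/esym/subr0_eq/(mono_eq0 s_gen) => l l0; apply/le_anti.
  rewrite (seminorm_ge0 (s_sn l0)) andbT; apply/ler_addgt0Pr => c c0.
  rewrite add0r; have cl := cG_gt0 l0.
  have e0 : 0 < Num.min (c / 2 / s k F) (c / 2 / cG l / s k F).
    by rewrite lt_min !divr_gt0.
  have [m0 hm0] := small _ e0; pose m := maxn l m0.
  have [] := hm0 m (leq_maxr _ _); rewrite !lt_min !ltr_pdivlMr//.
  move=> /andP[_ h1] /andP[h2 _].
  have lm : (l <= k + m)%N by rewrite (leq_trans (leq_maxl l m0))// leq_addl.
  (* The residual of [J m] and the image of the tail each contribute at most [c / 2]. *)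
  have -> : F - L (j F) = (F - L (J m F)) - L (j F - J m F).
    by rewrite (linearB L) opprB addrA subrK.
  apply: le_trans (seminormD (s_sn l0) _ _) _; rewrite (seminormN (s_sn l0)).
  rewrite (splitr c) lerD//.
    apply: le_trans (s_mono _ l0 lm) _.
    by apply: le_trans (ltW (Js m)) _; rewrite ler_pdivlMr// ltW.
  apply: le_trans (L_bound _ l0) _; rewrite mulrC ler_pdivlMr//.
  apply: le_trans _ (ltW h1); rewrite !ler_pM2r//.
  by apply: le_trans (q_mono _ l0 lm) _; exact: jP.
- move=> U /(mono_nbhsP q_mono q_gen)[l [r [l0 r0] sU]].
  (* Near [F] the values [s k G] stay below [s k F + 1], so one [m] makes the tail small at all
     these [G]: the convergence is locally uniform. *)
  have e0 : 0 < r / 4 / (s k F + 1) by rewrite !divr_gt0// ltr_wpDl// ltW.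
  have [m0 hm0] := small _ e0; pose m := maxn l m0.
  have [h1 _] := hm0 m (leq_maxr _ _).
  have lm : (l <= k + m)%N by rewrite (leq_trans (leq_maxl l m0))// leq_addl.
  have r4 : 0 < r / 4 by lra.
  have N1 := mono_near s_gen F k_gt0 (@ltr01 R).
  have N2 : \forall G \near F, 0 < s k G.
    by apply: near_lt_cvg (@s_cont k F k_gt0) F0; exact: cvg_cst.
  have N3 : \forall G \near F, q (k + m) (J m G - J m F) < r / 4.
    exact: Jc (mono_near q_gen (J m F) (kn_gt0 m) r4).
  apply: filterS3 N1 N2 N3 => G hG G0 hJ; apply: sU => /=.
  have tail H : 0 < s k H -> s k H <= s k F + 1 ->
      q (k + m) (j H - J m H) <= r / 4.
    move=> H0 HF; apply: le_trans (jP _ H0 m) _.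
    move: h1; rewrite ltr_pdivlMr ?ltr_wpDl ?(ltW F0)// => h1.
    apply: le_trans _ (ltW h1); rewrite ler_wpM2l// mulr_ge0 ?(ltW cH0)//.
    by rewrite subr_ge0.
  have hF : q (k + m) (j F - J m F) <= r / 4 by apply: tail; rewrite ?lerDl.
  have hGF : s k G <= s k F + 1.
    by have := seminorm_distl (s_sn k_gt0) G F; lra.
  have {}hG := tail _ G0 hGF.
  apply: le_lt_trans (q_mono _ l0 lm) _; have sq := q_sn (kn_gt0 m).
  have := seminormBD sq (J m G) (j G) (j F).
  have := seminormBD sq (J m F) (J m G) (j F).
  by rewrite [q _ (J m F - j F)](seminormBC sq); lra.
(* As [J 0 F] and [T 0] vanish, the tail estimate at index 0 is the bound sought. *)
- have := jP _ F0 0; rewrite J0 addn0 !subr0 => h.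
  by apply: le_trans h _; rewrite [cH k * _]mulrC.
Qed.

End Iteration.

End BartleGraves.

Theorem theorem8p1
  (R : realType)
  (* (A) *)
  (E : tvsType R) (q : nat -> E -> R)
  (E_frechet : frechet_space E)
  (q_mono : forall k l v, (0 < k)%N -> (k <= l)%N -> q k v <= q l v)
  (q_gen : generated_by (q @` [set k | (0 < k)%N]))
  (* (B) *)
  (X : tvsType R) (I : Type) (p : I -> X -> R)
  (p_gen : generated_by (range p))
  (p_filt : filtering p)
  (Xk : nat -> set X)
  (Xk_mono : forall k l, (0 < k)%N -> (k <= l)%N -> Xk k `<=` Xk l)
  (Xk_sub : forall k, (0 < k)%N -> submod_closed (mem (Xk k)))
  (Xk_closed : forall k, (0 < k)%N -> closed (Xk k))
  (Xk_cover : \bigcup_(k in [set k | (0 < k)%N]) Xk k = [set: X])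
  (* (C) *)
  (nu : X -> R)
  (nu_norm : is_norm nu)
  (nu_lsc : lower_semicontinuous (fun u => (nu u)%:E))
  (* (D) *)
  (C_compact : forall k, (0 < k)%N -> compact (level_set Xk nu k))
  (* (E) *)
  (D : E -> {linear X -> R^o})
  (D_linear : linear (fun v => D v : X -> R^o))
  (* (F) *)
  (D_F : forall (v : E) (eps : R), 0 < eps ->
     exists i, exists2 theta : R, 0 < theta &
       forall u, Xk `|Num.ceil eps^-1|%N u ->
         `|D v u| <= theta * p i u + eps * nu u)
  (* (G) *)
  (cG : nat -> R)
  (cG_gt0 : forall k, (0 < k)%N -> 0 < cG k)
  (D_G : forall k u v, (0 < k)%N -> Xk k u ->
     `|D v u| <= cG k * nu u * q k v)
  (* (H): the supremum is that of a set bounded above, by (G) *)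
  (cH : nat -> R)
  (cH_gt0 : forall k, (0 < k)%N -> 0 < cH k)
  (D_H : forall k u, (0 < k)%N -> Xk k u ->
     nu u <= cH k * sup [set `|D v u| | v in [set v | q k v <= 1]])
  (* (I) *)
  (D_I : forall k u, (0 < k)%N -> ~ Xk k u ->
     exists2 v, D v u != 0 & q k v = 0) :
  [/\ (* (K) *)
      frechet_space (localized_dual Xk nu),
      (forall k (F : localized_dual Xk nu), (0 < k)%N ->
         has_sup (unit_ball_values Xk nu k F)),
      generated_by
        [set (fun F : localized_dual Xk nu => dual_seminorm Xk nu k F)
          | k in [set k | (0 < k)%N]] &
      (* (L) *)
      exists DD : {linear E -> localized_dual Xk nu},
        [/\ forall v u, DD v u = D v u,
            continuous DD,
            (forall F, exists v, DD v = F),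
            (* (M) *)
            (forall (F : localized_dual Xk nu) k eps,
               (0 < k)%N -> 0 < dual_seminorm Xk nu k F -> 0 < eps ->
               exists2 v, F = DD v &
                 q k v <= (1 + eps) * cH k * dual_seminorm Xk nu k F) &
            (* (N) *)
            (forall k (eps : R), (0 < k)%N -> 0 < eps ->
               exists J : localized_dual Xk nu -> E,
                 let dom := [set F : localized_dual Xk nu |
                              0 < dual_seminorm Xk nu k F] in
                 [/\ forall F, dom F -> DD (J F) = F,
                     {within dom, continuous J} &
                     forall F, dom F -> q k (J F) <=
                       (1 + eps) * cH k * dual_seminorm Xk nu k F])]].
Proof.
have E_complete : linear_complete E by case: E_frechet.
have s_mono := fun k l (F : localized_dual Xk nu) =>
  @dual_seminorm_mono R X I p p_gen Xk Xk_mono Xk_sub nu nu_norm C_compact k l F.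
have s_gen := dual_generated p_gen Xk_mono Xk_sub Xk_closed Xk_cover nu_norm
  nu_lsc C_compact.
have [DD DDE] := operator_linear p_gen Xk_mono Xk_sub nu_norm D_linear D_F.
have bound k v := @operator_bound R E q q_gen X I p p_gen Xk Xk_sub nu nu_norm
  C_compact D cG cG_gt0 D_G DD DDE k v.
have approx k l G r eta := @operator_approx R E q q_gen X I p p_gen Xk Xk_sub nu
  nu_norm C_compact D D_linear cG cG_gt0 D_G cH cH_gt0 D_H D_I DD DDE
  k l G r eta.
have section k eps (k0 : (0 < k)%N) (eps0 : 0 < eps) :=
  bounded_continuous_section q_mono q_gen E_complete s_mono s_gen cG_gt0 bound
    cH_gt0 approx k0 eps0.
split=> //.
- exact: (dual_frechet p_gen Xk_mono Xk_sub Xk_closed Xk_cover nu_norm nu_lsc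
    C_compact).
- by move=> k F k0; exact: (unit_ball_has_sup p_gen Xk_sub nu_norm C_compact).
exists DD; split=> //.
- exact: (operator_continuous q_gen p_gen Xk_mono Xk_sub Xk_closed Xk_cover
    nu_norm nu_lsc C_compact cG_gt0 D_G DDE).
(* A section is controlled only where its seminorm is positive, so 0 is treated apart; any other [F]
   has a positive seminorm for some [k], and the tolerance 1 used there is arbitrary. *)
- move=> F; have [F0|] := pselect (F = 0); first by exists 0; rewrite F0 linear0.
  move=> F_neq0; have [k [k0 sF]] : exists k, (0 < k)%N /\
      0 < dual_seminorm Xk nu k F.
    apply: contrapT => nk; apply: F_neq0.
    apply: (dual_seminorm_eq0 p_gen Xk_sub Xk_cover nu_norm C_compact) => k k0.
    apply/le_anti; rewrite (dual_seminorm_ge0 p_gen Xk_sub nu_norm C_compact)//.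
    by rewrite andbT leNgt; apply/negP => sF; apply: nk; exists k.
  have [J JP] := section k 1 k0 ltr01.
  by have [DJ _ _] := JP F sF; exists (J F).
- move=> F k eps k0 sF eps0; have [J JP] := section k eps k0 eps0.
  by have [DJ _ qJ] := JP F sF; exists (J F).
- move=> k eps k0 eps0; have [J JP] := section k eps k0 eps0.
  exists J => dom; split.
  + by move=> F /JP[].
  + by apply: continuous_in_subspaceT => F /set_mem/JP[].
  + by move=> F /JP[].
Qed.
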